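(* Let $n\ge1$, $N\ge2$, $q\in[0,1)$, and fix type counts $(N_1,\dots,N_n)$ with $N_m\ge1$ for all $m$ and $N_1+\dots+N_n\le N$. Let the real parameters $u$, $v_1,\dots,v_n$, $s_1,\dots,s_n$ satisfy, with $z_m=\frac{u}{v_mq^{1/2}}$, $$0\le s_m<z_m,\qquad s_mz_m<1,\qquad m=1,\dots,n.$$ For $\eta\in\{0,\dots,n\}^N$ let $F_+(\eta)$ be the cylinder partition function with right boundary $\eta$ in which every vertex $(-m,j)$ carries the weight $w^{(-m),+}_{s_m,z_m}$. Then $F_+(\eta)>0$ for every $\eta$ with type counts $(N_1,\dots,N_n)$, and $$\mathrm{Prob}^{\mathrm{mASEP}}_{N_1,\dots,N_n}(\eta)=\frac{F_+(\eta)}{\sum_{\eta'}F_+(\eta')},$$ where the sum is over all $\eta'$ with type counts $(N_1,\dots,N_n)$ and the left-hand side is the stationary distribution of the multi-species ASEP on the ring in this sector.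
   Context: **Multi-species ASEP (mASEP) on the ring.** States $\eta=(\eta_1,\dots,\eta_N)\in\{0,\dots,n\}^N$ on $\mathbb Z/N\mathbb Z$; $\eta_k$ is the type at site $k$ ($0$ = hole). It is the continuous-time Markov chain in which, for each $k\in\mathbb Z/N\mathbb Z$ with $\eta_k\ne\eta_{k+1}$, the values at sites $k,k+1$ are swapped at rate $1$ if $\eta_k<\eta_{k+1}$ and rate $q$ if $\eta_k>\eta_{k+1}$. The type counts $N_m=\#\{j:\eta_j=m\}$, $1\le m\le n$, are conserved; in each sector the chain is irreducible and has a unique stationary distribution $\mathrm{Prob}^{\mathrm{mASEP}}_{N_1,\dots,N_n}$. **Gauge-transformed queue weights.** Fix $1\le m\le n$. Let $\mathbf A,\mathbf C$ be $n$-tuples with $A_m=C_m=+\infty$ and all other coordinates in $\mathbb Z_{\ge0}$; $\mathbf e_i$ are standard basis vectors (adding or subtracting $\mathbf e_m$ changes nothing), $A_{[a,b]}=\sum_{i=a}^bA_i$ (zero if $a>b$). Let $k\in\{0\}\cup\{m+1,\dots,n\}$ (color entering from the left, $0$ = none) and $\ell\in\{0,\dots,n\}$ (color exiting right). The weight $w^{(-m),+}_{s,z}(\mathbf A,k;\mathbf C,\ell)$ ($\mathbf A$ enters from below, $\mathbf C$ exits above) equals $\frac1{1-sz}$ times: - $1$ for $(\mathbf A,0;\mathbf A,0)$ and for $(\mathbf A,k;\mathbf A+\mathbf e_k,0)$, $k>m$; - $z(1-q^{A_\ell})q^{A_{[\ell+1,n]}}$ for $(\mathbf A,0;\mathbf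 A-\mathbf e_\ell,\ell)$, $\ell>m$; - $z\,q^{A_{[m+1,n]}}$ for $(\mathbf A,0;\mathbf A,m)$; - $s\,q^{A_{[m+1,n]}}$ for $(\mathbf A,k;\mathbf A+\mathbf e_k,m)$, $k>m$; - $(z-sq^{A_k})q^{A_{[k+1,n]}}$ for $(\mathbf A,k;\mathbf A,k)$, $k>m$; - $z(1-q^{A_\ell})q^{A_{[\ell+1,n]}}$ for $(\mathbf A,k;\mathbf A+\mathbf e_k-\mathbf e_\ell,\ell)$, $m<k<\ell$; - $s(1-q^{A_\ell})q^{A_{[\ell+1,n]}}$ for $(\mathbf A,k;\mathbf A+\mathbf e_k-\mathbf e_\ell,\ell)$, $m<\ell<k$; and all other weights are $0$. (For $q=0$ the $z_m$ are regarded as the parameters.) **Cylinder partition function.** Vertices are $(-m,j)$, $1\le m\le n$, $j\in\mathbb Z/N\mathbb Z$. For $\eta\in\{0,\dots,n\}^N$ in which every color $1,\dots,n$ occurs, the partition function with right boundary $\eta$ is the (convergent) sum $$\sum\ \prod_{m=1}^n\prod_{j=1}^N w_{m,j}\bigl(\mathbf A^{(m,j)},h_{m+1,j};\mathbf A^{(m,j+1)},h_{m,j}\bigr),$$ where $w_{m,j}$ is the weight at $(-m,j)$, over all $h_{m,j}\in\{0,\dots,n\}$ with $h_{n+1,j}=0$, $h_{1,j}=\eta_j$, and all vertical tuples $\mathbf A^{(m,j)}$ ($j$ cyclic mod $N$) with $(\mathbf A^{(m,j)})_m=+\infty$, $(\mathbf A^{(m,j)})_i=0$ for $i<m$, $(\mathbf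 A^{(m,j)})_i\in\mathbb Z_{\ge0}$ for $i>m$. *)

(* Defs.v *)
From HB Require Import structures.
From mathcomp Require Import all_boot all_order all_algebra all_fingroup.
From mathcomp Require Import all_classical all_reals ereal esum.

Set Implicit Arguments.
Unset Strict Implicit.
Unset Printing Implicit Defensive.

Import Order.TTheory GRing.Theory Num.Theory.

Local Open Scope classical_set_scope.
Local Open Scope ring_scope.

(* A state assigns to every site of Z/NZ (represented by 'I_N, with cyclic
   successor ordS) a type in {0, ..., n}, where 0 is a hole. *)
Definition state (n N : nat) := {ffun 'I_N -> 'I_n.+1}.

(* The colors 1, ..., n are indexed by 'I_n: the index i is the color i + 1. *)
Definition color (n : nat) (i : 'I_n) : 'I_n.+1 := lift ord0 i.

Definition sector (n N : nat) (cnt : 'I_n -> nat) : pred (state n N) :=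
  fun eta => [forall m : 'I_n, #|[pred j | eta j == color m]| == cnt m].

Section mASEP.
Variables (R : realType) (n N : nat) (q : R).

Definition swap (k : 'I_N) (eta : state n N) : state n N :=
  [ffun j => eta (tperm k (ordS k) j)].

Definition bond_rate (k : 'I_N) (eta : state n N) : R :=
  if (eta k < eta (ordS k))%N then 1
  else if (eta (ordS k) < eta k)%N then q
  else 0.

(* The sum matters for N = 2, where the two bonds produce the same swap. *)
Definition jump_rate (eta eta' : state n N) : R :=
  \sum_(k : 'I_N | swap k eta == eta') bond_rate k eta.

Definition generator (eta eta' : state n N) : R :=
  jump_rate eta eta' - (\sum_xi jump_rate eta xi) *+ (eta == eta').

Definition stationary_distribution (cnt : 'I_n -> nat)
    (pi : {ffun state n N -> R}) : Prop :=
  [/\ forall eta, 0 <= pi eta,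
      forall eta, ~~ sector cnt eta -> pi eta = 0,
      \sum_eta pi eta = 1 &
      forall eta', \sum_eta pi eta * generator eta eta' = 0].

End mASEP.

(* An n-tuple with coordinates in {0, 1, ...} u {+oo}; None stands for +oo. *)
Definition vtuple (n : nat) := {ffun 'I_n -> option nat}.

Section weights.
Variables (R : realType) (n : nat).
Implicit Types (A C : vtuple n) (k l : 'I_n.+1).

(* A + e_k and A - e_k. They fix infinite coordinates, and they are the
   identity for k = 0. The subtraction is truncated, which is harmless: every
   weight below with outcome A - e_l has a factor 1 - q ^ A_l. *)
Definition add_e A k : vtuple n :=
  [ffun i => if color i == k then omap succn (A i) else A i].
Definition sub_e A k : vtuple n :=
  [ffun i => if color i == k then omap predn (A i) else A i].

(* A_[a, b]; it is only used on ranges where all coordinates are finite. *)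
Definition range_sum A (a b : nat) : nat :=
  \sum_(i < n | (a <= color i <= b)%N) odflt 0%N (A i).

(* The weight of (A, k; C, l) at a vertex of the column of color m + 1. *)
Definition queue_weight (q s z : R) (m : 'I_n) A k C l : R :=
  let M : nat := color m in
  let qA (a b : nat) : R := q ^+ range_sum A a b in
  (1 - s * z)^-1 *
  (if [&& k == 0 :> nat, l == 0 :> nat & C == A] then 1
   else if [&& (M < k)%N, l == 0 :> nat & C == add_e A k] then 1
   else if [&& k == 0 :> nat, (M < l)%N & C == sub_e A l] then
     z * (1 - qA l l) * qA l.+1 n
   else if [&& k == 0 :> nat, l == M :> nat & C == A] then
     z * qA M.+1 n
   else if [&& (M < k)%N, l == M :> nat & C == add_e A k] then
     s * qA M.+1 n
   else if [&& (M < k)%N, l == k & C == A] then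
     (z - s * qA k k) * qA k.+1 n
   else if [&& (M < k)%N, (k < l)%N & C == sub_e (add_e A k) l] then
     z * (1 - qA l l) * qA l.+1 n
   else if [&& (M < l)%N, (l < k)%N & C == sub_e (add_e A k) l] then
     s * (1 - qA l l) * qA l.+1 n
   else 0).

End weights.

Section cylinder.
Variables (R : realType) (n N : nat).

(* A configuration is a pair (h, A). The color h_{r+1,j} is h (r, j) for
   0 <= r <= n, and the tuple A^(m+1,j) is A (m, j) for 0 <= m < n. *)
Definition configuration : Type :=
  ({ffun 'I_n.+1 * 'I_N -> 'I_n.+1} * {ffun 'I_n * 'I_N -> vtuple n})%type.

Definition admissible_vtuple (m : 'I_n) (A : vtuple n) : Prop :=
  forall i : 'I_n,
    [/\ (i < m)%N -> A i = Some 0%N, i = m -> A i = None & (m < i)%N -> A i].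

Definition configurations (eta : state n N) : set configuration :=
  [set c : configuration | [/\ forall j : 'I_N, c.1 (ord_max, j) = ord0,
               forall j : 'I_N, c.1 (ord0, j) = eta j &
               forall (m : 'I_n) (j : 'I_N), admissible_vtuple m (c.2 (m, j))]].

(* The column of color m + 1 is entered by h_{m+2,j} = h (m + 1, j) and exited
   by h_{m+1,j} = h (m, j). *)
Definition configuration_weight (q : R) (s z : 'I_n -> R)
    (c : configuration) : R :=
  \prod_(m < n) \prod_(j < N)
    queue_weight q (s m) (z m) m
      (c.2 (m, j)) (c.1 (lift ord0 m, j))
      (c.2 (m, ordS j)) (c.1 (widen_ord (leqnSn n) m, j)).

Definition convergent_partition_function (q : R) (s z : 'I_n -> R)
    (eta : state n N) : Prop :=
  summable (configurations eta)
    (fun c => (configuration_weight q s z c)%:E).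

(* \esum is the supremum of the finite partial sums, hence it is the sum of the
   series when the weights are nonnegative, as they are for 0 <= q < 1,
   0 <= s_m < z_m and s_m z_m < 1. *)
Definition partition_function (q : R) (s z : 'I_n -> R)
    (eta : state n N) : R :=
  fine (\esum_(c in configurations eta) (configuration_weight q s z c)%:E).

End cylinder.

(* Main.v *)
Require Import Defs.
From mathcomp Require Import all_boot all_order all_algebra all_fingroup.
From mathcomp Require Import all_classical all_reals ereal esum.
From mathcomp Require Import sequences normedtype topology.
From mathcomp Require Import ring lra zify.

(* Each column of the cylinder acts as a transfer matrix from colorings by
   {0, m + 1, ..., n} to colorings by {0, m, ..., n}, and each of these matrices
   intertwines the generators of mASEP. For a bond, this is the derivative of
   the Yang-Baxter equation at coinciding spectral parameters: the commutator of
   the exchange rates with a product of two adjacent vertex weights is a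
   difference of two products in which one of the weights is replaced by its
   z-derivative, and these differences telescope around the ring. The partition
   function is the product of the transfer matrices applied to the empty
   coloring, so it is stationary. The column sums converge because color m occurs
   in the output, which produces a factor q ^ A_[m+1,n] at some site, while the
   tuple at one site determines the whole column. Uniqueness does not need the
   irreducibility for q = 0 to be proved directly: the Dirichlet form of the
   ratio of a stationary measure to the positive one vanishes, so the ratio is
   invariant under all adjacent swaps. *)

Set Implicit Arguments.
Unset Strict Implicit.
Unset Printing Implicit Defensive.

Import Order.TTheory GRing.Theory Num.Theory.

Local Open Scope classical_set_scope.
Local Open Scope ring_scope.

(** * Local exchange relation *)

Section local_relation.
Variables (R : comNzRingType) (q s z : R).

Definition exch_rate (a b : nat) : R :=
  if (a < b)%N then 1 else if (b < a)%N then q else 0.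

(** With [x] = q^(A_l), this is the queue weight without its prefactor and without the power of q
    counting the colors above [l]. The value [x] = 0 covers the color of infinite multiplicity. *)
Definition vertex_coef (k l : nat) (x : R) : R :=
  if l == 0%N then 1 else if k == l then z - s * x
  else (if (k < l)%N then z else s) * (1 - x).

Definition vertex_coef_der (k l : nat) (x : R) : R :=
  if l == 0%N then 0 else if k == l then z
  else if (k < l)%N then z * (1 - x) else 0.

(* [X k] and [Q k] are the values of a color power x' and of a product P' of color
   powers after a move that removes the color [l] and adds the color [k]. In the
   first case [l] is absent, and then only [k = l] has a nonzero weight. The
   second case expresses everything through the state with one [l] removed, which
   avoids dividing by [q]. *)
Definition lowering_spec (l l' : nat) (x x' P' : R) (X Q : nat -> R) : Prop :=
  [/\ (0 < l)%N, x = 1 & forall k, k = l -> X k = x' /\ Q k = P'] \/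
  exists y W, [/\ x' = (if (l == l') && (0 < l')%N then q else 1) * y,
                  P' = (if (0 < l' < l)%N then q else 1) * W &
                  forall k, X k = (if (k == l') && (0 < l')%N then q else 1) * y /\
                            Q k = (if (0 < l' < k)%N then q else 1) * W].

(** Equal exit colors: the exchange rate of the outputs is zero, and what is left is a polynomial
    identity for each relative order of [k1], [k2] and [l]. *)
Lemma scalar_exchange_eq (k1 k2 l : nat) (x P : R) (X Q : nat -> R) :
  lowering_spec l l x x P X Q ->
  exch_rate k1 k2 * ((vertex_coef k1 l x * P) * (vertex_coef k2 l (X k1) * Q k1))
  + (1 - q) * ((vertex_coef k1 l x * P) * (vertex_coef_der k2 l (X k1) * Q k1))
  = exch_rate k1 k2 * ((vertex_coef k2 l x * P) * (vertex_coef k1 l (X k2) * Q k2))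
  + (1 - q) * ((vertex_coef_der k1 l x * P) * (vertex_coef k2 l (X k1) * Q k1)).
Proof.
rewrite /exch_rate /vertex_coef /vertex_coef_der.
case=> [[l0 -> XQ]|[y [W [-> -> XQ]]]].
  have -> : (l == 0)%N = false by lia.
  case: (ltngtP k1 l) => h1; case: (ltngtP k2 l) => h2;
    case: (ltngtP k1 k2) => h3; try lia;
    rewrite ?(proj1 (XQ _ h1)) ?(proj2 (XQ _ h1))
            ?(proj1 (XQ _ h2)) ?(proj2 (XQ _ h2)); ring.
have [-> ->] := XQ k1; have [-> ->] := XQ k2.
case: l {XQ} => [|l] /=; first by case: (ltngtP k1 k2) => h; ring.
rewrite eqxx ltnn /=.
case: (ltngtP k1 l.+1) => h1; case: (ltngtP k2 l.+1) => h2;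
  case: (ltngtP k1 k2) => h3; try lia; rewrite ?ltn0Sn /=; ring.
Qed.

Lemma scalar_exchange_neq (k1 k2 l1 l2 : nat) (x1 x2 P1 P2 : R)
    (X12 Q12 X21 Q21 : nat -> R) : l1 != l2 ->
  lowering_spec l1 l2 x1 x2 P2 X12 Q12 ->
  lowering_spec l2 l1 x2 x1 P1 X21 Q21 ->
  exch_rate l2 l1 * ((vertex_coef k1 l2 x2 * P2) * (vertex_coef k2 l1 (X21 k1) * Q21 k1))
  + exch_rate k1 k2 * ((vertex_coef k1 l1 x1 * P1) * (vertex_coef k2 l2 (X12 k1) * Q12 k1))
  + (1 - q) * ((vertex_coef k1 l1 x1 * P1) * (vertex_coef_der k2 l2 (X12 k1) * Q12 k1))
  = exch_rate l1 l2 * ((vertex_coef k1 l1 x1 * P1) * (vertex_coef k2 l2 (X12 k1) * Q12 k1))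
  + exch_rate k1 k2 * ((vertex_coef k2 l1 x1 * P1) * (vertex_coef k1 l2 (X12 k2) * Q12 k2))
  + (1 - q) * ((vertex_coef_der k1 l1 x1 * P1) * (vertex_coef k2 l2 (X12 k1) * Q12 k1)).
Proof.
move=> ne H12 H21.
have E12 : (l1 == l2) = false by apply/negbTE.
have E21 : (l2 == l1) = false by rewrite eq_sym.
rewrite /exch_rate /vertex_coef /vertex_coef_der.
case: H12 => [[l10 X1 XQ]|[y2 [W2 [Y2 Y2' XQ]]]].
  have -> : (l1 == 0)%N = false by lia.
  case: H21 => [[l20 X2 XQ']|[y1 [W1 [Y1 Y1' XQ']]]].
    have -> : (l2 == 0)%N = false by lia.
    case: (ltngtP k1 l1) => h1; case: (ltngtP k1 l2) => h2; try lia;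
    case: (ltngtP k2 l1) => h3; case: (ltngtP k2 l2) => h4; try lia;
    case: (ltngtP l1 l2) => h6; try lia;
    case: (ltngtP k1 k2) => h5; try lia;
    rewrite ?(proj1 (XQ _ h1)) ?(proj2 (XQ _ h1))
            ?(proj1 (XQ _ h3)) ?(proj2 (XQ _ h3))
            ?(proj1 (XQ' _ h2)) ?(proj2 (XQ' _ h2))
            ?(proj1 (XQ' _ h4)) ?(proj2 (XQ' _ h4)) ?X1 ?X2; ring.
  (* Removing one [l2] does not change the power of the other color [l1], which is absent, so [y1]
     is still q^0. *)
  have {}Y1 : y1 = 1 by rewrite -X1 Y1 E21 mul1r.
  have [-> ->] := XQ' k1; rewrite Y1' Y1 X1 l10 {XQ' Y1' Y1 E12 E21}.
  have [e0|p0] := posnP l2; [rewrite e0 in XQ ne *|];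
    case: (ltngtP k1 l1) => h1; case: (ltngtP k1 l2) => h2; try lia;
    case: (ltngtP k2 l1) => h3; case: (ltngtP k2 l2) => h4; try lia;
    case: (ltngtP l1 l2) => h6; try lia;
    case: (ltngtP k1 k2) => h5; try lia;
    rewrite ?(proj1 (XQ _ h1)) ?(proj2 (XQ _ h1))
            ?(proj1 (XQ _ h3)) ?(proj2 (XQ _ h3)) ?l10 /=; ring.
case: H21 => [[l20 X2 XQ']|[y1 [W1 [Y1 Y1' XQ']]]].
  have {}Y2 : y2 = 1 by rewrite -X2 Y2 E12 mul1r.
  have -> : (l2 == 0)%N = false by lia.
  have [-> ->] := XQ k1; have [-> ->] := XQ k2.
  rewrite Y2' Y2 X2 l20 {XQ Y2' Y2 E12 E21}.
  have [e0|p0] := posnP l1; [rewrite e0 in XQ' ne *|];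
    case: (ltngtP k1 l1) => h1; case: (ltngtP k1 l2) => h2; try lia;
    case: (ltngtP k2 l1) => h3; case: (ltngtP k2 l2) => h4; try lia;
    case: (ltngtP l1 l2) => h6; try lia;
    case: (ltngtP k1 k2) => h5; try lia;
    rewrite ?(proj1 (XQ' _ h2)) ?(proj2 (XQ' _ h2)) ?l20 /=; ring.
have [-> ->] := XQ k1; have [-> ->] := XQ k2; have [-> ->] := XQ' k1.
rewrite Y1' Y2' {XQ XQ' Y1' Y2'}.
have [e1|p1] := posnP l1; have [e2|p2] := posnP l2; first by lia.
- rewrite e1 in E12 E21 *.
  rewrite e1 ?E12 ?E21 /= ?andbF !mul1r in Y1 Y2; rewrite ?Y1 ?Y2 ?p2 /= {Y1 Y2}.
  case: (ltngtP k1 l2) => h2; case: (ltngtP k2 l2) => h4; try lia;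
    case: (ltngtP k1 k2) => h5; try lia; rewrite /= ?andbF ?ltn0; ring.
- rewrite e2 in E12 E21 *.
  rewrite e2 ?E12 ?E21 /= ?andbF !mul1r in Y1 Y2; rewrite ?Y1 ?Y2 ?p1 /= {Y1 Y2}.
  case: (ltngtP k1 l1) => h2; case: (ltngtP k2 l1) => h4; try lia;
    case: (ltngtP k1 k2) => h5; try lia; rewrite /= ?andbF ?ltn0; ring.
- rewrite E12 E21 /= !mul1r in Y1 Y2; rewrite ?Y1 ?Y2 ?p1 ?p2 /= {Y1 Y2}.
  case: (ltngtP k1 l1) => h1; case: (ltngtP k1 l2) => h2; try lia;
    case: (ltngtP k2 l1) => h3; case: (ltngtP k2 l2) => h4; try lia;
    case: (ltngtP l1 l2) => h6; try lia;
    case: (ltngtP k1 k2) => h5; try lia; rewrite /=; ring.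
Qed.
End local_relation.

(** * Moves of a vertical tuple and the resulting powers of q *)

Lemma colorE n (i : 'I_n) : color i = i.+1 :> nat.
Proof. by rewrite /color lift0. Qed.

Lemma color_inj n : injective (@color n).
Proof. exact: lift_inj. Qed.

Lemma colorP n (l : 'I_n.+1) : (0 < l)%N -> exists i, l = color i.
Proof.
move=> l0; have : l != ord0 by rewrite -val_eqE /= -lt0n.
by rewrite eq_sym => /unlift_some[i -> _]; exists i.
Qed.

Section vertical_moves.
Variable n : nat.
Implicit Types (a : vtuple n) (k l : 'I_n.+1).

(** Adding before subtracting makes the move with [k] = [l] the identity even when the color is
    absent, in spite of the truncated subtraction. *)
Definition net_move a k l : vtuple n := sub_e (add_e a k) l.

Lemma add_eK a k : sub_e (add_e a k) k = a.
Proof.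
apply/ffunP => i; rewrite !ffunE; case: eqP => // _.
by case: (a i).
Qed.

Lemma add_eC a k l : add_e (add_e a k) l = add_e (add_e a l) k.
Proof. by apply/ffunP => i; rewrite !ffunE; case: eqP; case: eqP. Qed.

Lemma net_move_add b k l : net_move (add_e b l) k l = add_e b k.
Proof. by rewrite /net_move add_eC add_eK. Qed.

Lemma net_move_id a k : net_move a k k = a.
Proof. exact: add_eK. Qed.

Lemma sub_eK a i : a i != Some 0%N -> add_e (sub_e a (color i)) (color i) = a.
Proof.
move=> ai; apply/ffunP => j; rewrite !ffunE; case: eqP => // /color_inj ->.
by case: (a i) ai => // -[].
Qed.

Lemma add_e0 a : add_e a ord0 = a.
Proof. by apply/ffunP => i; rewrite ffunE. Qed.

Lemma sub_e0 a : sub_e a ord0 = a.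
Proof. by apply/ffunP => i; rewrite ffunE. Qed.

End vertical_moves.

Section occupation_powers.
Variables (R : comNzRingType) (n : nat) (q : R).
Implicit Types (a : vtuple n) (k l : 'I_n.+1).

(* q ^ A_i, with the value q ^ oo = 0 at an infinite coordinate *)
Definition occ_pow (o : option nat) : R := if o is Some t then q ^+ t else 0.

(** The product has at most one factor; it gives the value 1 to the color 0, which has no
    coordinate. *)
Definition color_pow a l : R := \prod_(i < n | color i == l) occ_pow (a i).

(** The value 1 at [l] = 0 reflects that a vertex without exiting color carries no power of q. *)
Definition above_pow a l : R :=
  if l == ord0 then 1 else \prod_(i < n | (l < color i)%N) occ_pow (a i).

Lemma color_powE a i : color_pow a (color i) = occ_pow (a i).
Proof. by rewrite /color_pow (big_pred1 i). Qed.

Lemma occ_pow0 : occ_pow (Some 0%N) = 1.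
Proof. exact: expr0. Qed.

Lemma occ_pow_succ (o : option nat) : occ_pow (omap succn o) = q * occ_pow o.
Proof. by case: o => [t|] /=; rewrite ?exprS ?mulr0. Qed.

Lemma color_pow_add a k l :
  color_pow (add_e a k) l
  = (if ((k : nat) == l) && (0 < l)%N then q else 1) * color_pow a l.
Proof.
rewrite /color_pow; have [l0|/colorP[i ->]] := posnP l.
  have -> : l = ord0 by apply: val_inj.
  by rewrite andbF !big_pred0 ?mulr1.
have E j : (color j == color i) = (j == i) by rewrite (inj_eq (@color_inj n)).
rewrite !(big_pred1 i) // ffunE andbT -val_eqE /= (eq_sym (val (color i))).
by case: eqP => _; rewrite ?mul1r ?occ_pow_succ.
Qed.

Lemma above_pow_add a k l :
  above_pow (add_e a k) l
  = (if (0 < l < k)%N then q else 1) * above_pow a l.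
Proof.
rewrite /above_pow; have [l0|l0] := posnP l.
  have -> : l = ord0 by apply: val_inj.
  by rewrite eqxx mul1r.
have -> : (l == ord0) = false by rewrite -val_eqE /= gtn_eqF.
case: ltnP => [lk|kl] /=.
  have /colorP[i ek] : (0 < k)%N by apply: leq_ltn_trans lk.
  have li : (l < color i)%N by rewrite -ek.
  rewrite (bigD1 i) // [in RHS](bigD1 i) //= mulrA.
  rewrite ffunE ek eqxx occ_pow_succ; congr (_ * _ * _).
  apply: eq_bigr => j /andP[_ ji]; rewrite ffunE (inj_eq (@color_inj n)).
  by rewrite (negbTE ji).
rewrite mul1r; apply: eq_bigr => j lj; rewrite ffunE; case: eqP => // e.
have : (l < k)%N by rewrite -e.
by rewrite ltnNge kl.
Qed.

(** These are the two alternatives of [lowering_spec]. An infinite coordinate, and the color 0, fall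
    under the second one. *)
Lemma color_pow_sub a l :
  ((0 < l)%N /\ color_pow a l = 1) \/ (exists b, a = add_e b l).
Proof.
have [l0|/colorP[i ->]] := posnP l.
  right; exists a; apply/ffunP => j; rewrite ffunE.
  by rewrite (_ : l = ord0) //; apply: val_inj.
have [e|ne] := eqVneq (a i) (Some 0%N).
  by left; rewrite color_powE e occ_pow0; split=> //.
by right; exists (sub_e a (color i)); rewrite sub_eK.
Qed.

Variables (s z : R).

Definition num_weight a k l : R := vertex_coef s z k l (color_pow a l) * above_pow a l.

Definition der_weight a k l : R := vertex_coef_der z k l (color_pow a l) * above_pow a l.

(* The derivative of the Yang-Baxter equation at coinciding spectral
   parameters: [der_weight] is [z] times the [z]-derivative of [num_weight]. *)
Lemma local_exchange a k1 k2 l1 l2 :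
  exch_rate q l2 l1 * (num_weight a k1 l2 * num_weight (net_move a k1 l2) k2 l1)
  + exch_rate q k1 k2 *
      (num_weight a k1 l1 * num_weight (net_move a k1 l1) k2 l2)
  + (1 - q) * (num_weight a k1 l1 * der_weight (net_move a k1 l1) k2 l2)
  = exch_rate q l1 l2 *
      (num_weight a k1 l1 * num_weight (net_move a k1 l1) k2 l2)
  + exch_rate q k1 k2 *
      (num_weight a k2 l1 * num_weight (net_move a k2 l1) k1 l2)
  + (1 - q) * (der_weight a k1 l1 * num_weight (net_move a k1 l1) k2 l2).
Proof.
(* [X] and [Q] take natural numbers, hence [inord] when [l] is absent. When [l] is present, they are
   explicit in the tuple [b] with one [l] removed. *)
have spec l l' : exists X Q,
    lowering_spec q l l' (color_pow a l) (color_pow a l') (above_pow a l') X Q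
    /\ forall k, color_pow (net_move a k l) l' = X k /\
                 above_pow (net_move a k l) l' = Q k.
  case: (color_pow_sub a l) => [[l0 e]|[b ->]].
    exists (fun k : nat => color_pow (net_move a (inord k) l) l'),
           (fun k : nat => above_pow (net_move a (inord k) l) l').
    split; last by move=> k; rewrite inord_val.
    by left; split=> // k ->; rewrite inord_val net_move_id.
  exists (fun k : nat => (if (k == l') && (0 < l')%N then q else 1) * color_pow b l'),
         (fun k : nat => (if (0 < l' < k)%N then q else 1) * above_pow b l').
  split; last by move=> k; rewrite net_move_add color_pow_add above_pow_add.
  right; exists (color_pow b l'), (above_pow b l').
  by rewrite color_pow_add above_pow_add.
rewrite /= /num_weight /der_weight.
have [X [Q [HX EX]]] := spec l1 l2.
rewrite !(proj1 (EX _)) !(proj2 (EX _)).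
have [e|ne] := eqVneq l1 l2.
  subst l2; rewrite !(proj1 (EX _)) !(proj2 (EX _)).
  have -> : exch_rate q l1 l1 = 0 by rewrite /exch_rate ltnn.
  by rewrite !mul0r !add0r; apply: scalar_exchange_eq.
have [Y [P [HY EY]]] := spec l2 l1.
rewrite !(proj1 (EY _)) !(proj2 (EY _)).
exact: scalar_exchange_neq.
Qed.

(** Both moves at once, truncated only at the end, so that the result is symmetric in the entering
    and in the exiting colors. This puts one and the same final tuple in all terms of the exchange
    relation. *)
Definition net_move2 a k1 k2 l1 l2 : vtuple n :=
  [ffun i => omap (fun t => (t + (color i == k1) + (color i == k2))
                            - ((color i == l1) + (color i == l2)))%N (a i)].

Lemma net_move2_perml a k1 k2 l1 l2 :
  net_move2 a k1 k2 l1 l2 = net_move2 a k2 k1 l1 l2.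
Proof.
by apply/ffunP => i; rewrite !ffunE; case: (a i) => //= t; rewrite addnAC.
Qed.

Lemma net_move2_permr a k1 k2 l1 l2 :
  net_move2 a k1 k2 l1 l2 = net_move2 a k1 k2 l2 l1.
Proof.
apply/ffunP => i; rewrite !ffunE; case: (a i) => //= t.
by rewrite (addnC (color i == l1)).
Qed.

Lemma net_moveE a k l i :
  net_move a k l i = omap (fun t => t + (color i == k) - (color i == l))%N (a i).
Proof.
rewrite !ffunE; case: (a i) => [t|]; case: (color i == k);
  case: (color i == l) => //=; congr Some; lia.
Qed.

(** The condition under which the subtraction in [net_move] does not truncate. *)
Definition can_move a k l : Prop :=
  forall i t, a i = Some t -> ((color i == l) <= (color i == k) + t)%N.

Lemma net_move_net_move a k1 k2 l1 l2 :
  can_move a k1 l1 -> can_move (net_move a k1 l1) k2 l2 ->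
  net_move (net_move a k1 l1) k2 l2 = net_move2 a k1 k2 l1 l2.
Proof.
move=> m1 m2; apply/ffunP => i.
have := m1 i; have := m2 i; rewrite !net_moveE ffunE.
case: (a i) => [t|] //= /(_ _ erefl) h2 /(_ _ erefl) h1; congr Some.
move: h1 h2; move: (nat_of_bool (color i == k1)) (nat_of_bool (color i == k2))
  (nat_of_bool (color i == l1)) (nat_of_bool (color i == l2)) => b1 b2 b3 b4.
lia.
Qed.

Lemma can_moveP a k l :
  (forall i, color i = l -> k <> l -> a i <> Some 0%N) -> can_move a k l.
Proof.
move=> H i t e; have := H i; rewrite e.
case: (eqVneq (color i) l) => // el /(_ el); rewrite -el.
by case: eqVneq => //= ne /(_ (nesym (elimN eqP ne))); case: t {e}.
Qed.

(** Truncation would require an absent color [l] different from [k], and then the factor 1 - q^0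
    vanishes. *)
Lemma num_weight_can_move a k l : num_weight a k l != 0 -> can_move a k l.
Proof.
move=> nz; apply: can_moveP => i ei kl ai; move: nz.
have kl' : ((k : nat) == i.+1) = false.
  by apply/negP => /eqP e; apply: kl; apply: val_inj; rewrite -ei /= e -colorE.
rewrite /num_weight /vertex_coef -ei color_powE ai occ_pow0 colorE kl' /=.
by rewrite subrr mulr0 mul0r eqxx.
Qed.

Lemma der_weight_can_move a k l : der_weight a k l != 0 -> can_move a k l.
Proof.
move=> nz; apply: can_moveP => i ei kl ai; move: nz.
have kl' : ((k : nat) == i.+1) = false.
  by apply/negP => /eqP e; apply: kl; apply: val_inj; rewrite -ei /= e -colorE.
rewrite /der_weight /vertex_coef_der -ei color_powE ai occ_pow0 colorE kl' /=.
by rewrite subrr mulr0; case: ifP; rewrite mul0r eqxx.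
Qed.

End occupation_powers.

(** * Sums over infinite index sets *)

Section extended_sums.
Variable R : realType.

(** One inequality is checked on finite partial sums; the other one is the same inequality for the
    factor c^-1 and the family [c * f]. *)
Lemma esumZ (T : choiceType) (D : set T) (c : R) (f : T -> \bar R) :
  0 <= c -> (forall x, D x -> (0 <= f x)%E) ->
  (\esum_(x in D) (c%:E * f x) = c%:E * \esum_(x in D) f x)%E.
Proof.
rewrite le_eqVlt => /predU1P[<- _|].
  by rewrite mul0e esum1 // => x _; rewrite mul0e.
have le (b : R) (g : T -> \bar R) : 0 < b -> (forall x, D x -> (0 <= g x)%E) ->
    (\esum_(x in D) (b%:E * g x) <= b%:E * \esum_(x in D) g x)%E.
  move=> b0 g0; apply: ge_ereal_sup => _ [X [finX XD] <-].
  rewrite fsbig_finite // big_seq.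
  rewrite -ge0_sume_distrr; last first.
    by move=> i; rewrite in_fset_set // inE => /XD/g0.
  rewrite -big_seq -fsbig_finite //.
  apply: lee_wpmul2l; first by rewrite lee_fin ltW.
  by apply: esum_ge; exists X.
move=> c0 f0; apply/eqP; rewrite eq_le le //=.
have := le c^-1 (fun x => (c%:E * f x)%E).
rewrite invr_gt0 => /(_ c0) => H.
have {}H := H (fun x Dx => mule_ge0 (ltW c0 : (0 <= c%:E)%E) (f0 x Dx)).
rewrite (eq_esum (b := f)) in H; last first.
  by move=> x _; rewrite muleA -EFinM mulVf ?gt_eqF // mul1e.
have := lee_wpmul2l (ltW c0 : (0 <= c%:E)%E) H.
by rewrite muleA -EFinM divff ?gt_eqF // mul1e.
Qed.

Lemma esum_single (T : choiceType) (D : set T) (t : T) (f : T -> \bar R) :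
  D t -> (forall x, D x -> (0 <= f x)%E) -> (forall x, D x -> x <> t -> f x = 0%E) ->
  \esum_(x in D) f x = f t.
Proof.
move=> Dt f0 fx; rewrite (esumID [set t]) //.
have -> : D `&` [set t] = [set t] by apply/seteqP; split => [x []|x ->].
rewrite esum_set1 ?f0 // esum1 ?adde0 // => x [Dx /= xt]; exact: fx.
Qed.

Lemma esum_support (T : choiceType) (D C : set T) (f : T -> \bar R) :
  (forall x, D x -> (0 <= f x)%E) -> (forall x, D x -> ~ C x -> f x = 0%E) ->
  \esum_(x in D) f x = \esum_(x in D `&` C) f x.
Proof.
move=> f0 fC; rewrite (esumID C) // [X in (_ + X)%E]esum1 ?adde0 //.
by move=> x [Dx nC]; exact: fC.
Qed.

Lemma esum_subset (T : choiceType) (D E : set T) (f : T -> \bar R) :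
  D `<=` E -> (forall x, E x -> (0 <= f x)%E) ->
  (\esum_(x in D) f x <= \esum_(x in E) f x)%E.
Proof.
move=> DE f0; rewrite [leRHS](esumID D) // (setIidr DE) leeDl // esum_ge0 //.
by move=> x [Ex _]; exact: f0.
Qed.

Lemma esum_geometric (q : R) : 0 <= q -> q < 1 ->
  (\esum_(t in [set: nat]) (q ^+ t)%:E <= ((1 - q)^-1)%:E)%E.
Proof.
move=> q0 q1; rewrite -nneseries_esumT => [|t]; last by rewrite lee_fin exprn_ge0.
apply: lime_le; first by apply: is_cvg_nneseries => t _ _; rewrite lee_fin exprn_ge0.
apply: nearW => t; rewrite sumEFin lee_fin big_mkord.
rewrite -[leRHS]mul1r ler_pdivlMr ?subr_gt0 //.
have -> : (\sum_(i < t) q ^+ i) * (1 - q) = 1 - q ^+ t.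
  by rewrite [LHS]mulrC -opprB mulNr -subrX1 opprB.
by rewrite lerBlDr lerDl exprn_ge0.
Qed.

End extended_sums.

Section ffun_cons.
Variables (n : nat) (T : Type).

Definition ffun_cons (x : T) (f : {ffun 'I_n -> T}) : {ffun 'I_n.+1 -> T} :=
  [ffun i => oapp f x (unlift ord0 i)].

Definition ffun_tail (f : {ffun 'I_n.+1 -> T}) : {ffun 'I_n -> T} :=
  [ffun i => f (lift ord0 i)].

Lemma ffun_cons0 x f : ffun_cons x f ord0 = x.
Proof. by rewrite ffunE unlift_none. Qed.

Lemma ffun_consS x f i : ffun_cons x f (lift ord0 i) = f i.
Proof. by rewrite ffunE liftK. Qed.

Lemma ffun_consK x f : ffun_tail (ffun_cons x f) = f.
Proof. by apply/ffunP => i; rewrite ffunE ffun_consS. Qed.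

Lemma ffun_tailK (f : {ffun 'I_n.+1 -> T}) : ffun_cons (f ord0) (ffun_tail f) = f.
Proof.
apply/ffunP => i; rewrite ffunE; case: unliftP => [j|] -> //=.
by rewrite ffunE.
Qed.

End ffun_cons.

Section esum_product.
Variables (R : realType) (T : choiceType).

(** Tonelli, by induction on the number of coordinates with the first one split off. It is applied
    to the coordinates of one tuple and to the columns of the cylinder. *)
Lemma esum_prod n (D : 'I_n -> set T) (f : 'I_n -> T -> R) (S : 'I_n -> R) :
  (forall i t, D i t -> 0 <= f i t) ->
  (forall i, \esum_(t in D i) (f i t)%:E = (S i)%:E) ->
  \esum_(A in [set A : {ffun 'I_n -> T} | forall i, D i (A i)])
     (\prod_(i < n) f i (A i))%:E = (\prod_(i < n) S i)%:E.
Proof.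
elim: n D f S => [|n IH] D f S f0 fS.
  have e0 (A B : {ffun 'I_0 -> T}) : A = B by apply/ffunP => -[].
  have t0 : {ffun 'I_0 -> T} by apply: finfun => -[].
  rewrite (@esum_single _ _ _ t0).
  - by rewrite !big_ord0.
  - by case.
  - by move=> x _; rewrite big_ord0 lee_fin.
  - by move=> x _ /(_ (e0 x t0)).
set DS := [set A : {ffun 'I_n -> T} | forall i, D (lift ord0 i) (A i)].
(* A family is the same as its first entry together with its tail. *)
rewrite (reindex_esum (D ord0 `*`` (fun=> DS)) _ (fun p => ffun_cons p.1 p.2));
    last first.
  split.
  - move=> [x A] /= [Dx DA] i; rewrite ffunE; case: unliftP => [j|] -> //=.
  - move=> [x A] [y B] _ _ /= e; congr (_, _).
      by rewrite -(ffun_cons0 x A) e ffun_cons0.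
    by rewrite -(ffun_consK x A) e ffun_consK.
  - move=> A DA; exists (A ord0, ffun_tail A); last exact: ffun_tailK.
    by split=> //= i; rewrite ffunE.
rewrite (eq_esum (b := fun p : T * {ffun 'I_n -> T} => ((f ord0 p.1)%:E *
    (\prod_(i < n) f (lift ord0 i) (p.2 i))%:E)%E)); last first.
  move=> [x A] _ /=; rewrite -EFinM big_ord_recl ffun_cons0; congr (_ * _)%:E.
  by apply: eq_bigr => i _; rewrite ffun_consS.
rewrite -(@esum_esum _ _ _ (D ord0) (fun=> DS)
  (fun x A => (f ord0 x)%:E * (\prod_(i < n) f (lift ord0 i) (A i))%:E)%E);
  last first.
  move=> x A Dx DA; rewrite mule_ge0 ?lee_fin ?f0 // prodr_ge0 // => i _.
  exact: f0.
rewrite (eq_esum (b := fun x => ((\prod_(i < n) S (lift ord0 i))%:E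
   * (f ord0 x)%:E)%E)); last first.
  move=> x Dx; rewrite esumZ ?f0 //; last first.
    by move=> A DA; rewrite lee_fin prodr_ge0 // => i _; exact: f0.
  rewrite muleC; congr (_ * _)%E.
  by apply: (IH (fun i => D (lift ord0 i)) (fun i => f (lift ord0 i))
    (fun i => S (lift ord0 i))) => i *; [exact: f0 | exact: fS].
rewrite esumZ ?fS; last first.
- by move=> x Dx; rewrite lee_fin f0.
- rewrite prodr_ge0 // => i _; rewrite -lee_fin -fS esum_ge0 // => x Dx.
  by rewrite lee_fin f0.
by rewrite big_ord_recl -EFinM mulrC.
Qed.

End esum_product.

(** * Queue weights *)

Section vertex_weights.
Variables (R : realType) (n : nat) (q s z : R) (m : 'I_n).
Implicit Types (a c : vtuple n) (k l : 'I_n.+1).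

(** The index [m] stands for the color m + 1, which may exit from its column but not enter it. *)
Definition in_color k : bool := (k == 0%N :> nat) || (m.+1 < k)%N.
Definition out_color l : bool := (l == 0%N :> nat) || (m.+1 <= l)%N.

(** For [b] = true only the numerator is differentiated; the prefactor stays as it is and is common
    to all terms of the exchange relation. *)
Definition vertex_rate (b : bool) a k l : R :=
  (1 - s * z)^-1 * ((in_color k)%:R * (out_color l)%:R *
    (if b then der_weight q z a k l else num_weight q s z a k l)).

Definition vertex_weight (b : bool) a k c l : R :=
  vertex_rate b a k l * (c == net_move a k l)%:R.

Lemma admissible_occ_pow a (i : 'I_n) : admissible_vtuple m a -> (m < i)%N ->
  occ_pow q (a i) = q ^+ odflt 0%N (a i).
Proof. by move=> /(_ i)[_ _ H] /H; case: (a i). Qed.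

Lemma above_powE a l : admissible_vtuple m a -> (m < l)%N ->
  above_pow q a l = q ^+ range_sum a l.+1 n.
Proof.
move=> Ha ml; rewrite /above_pow /range_sum.
have -> : (l == ord0) = false by apply/negP => /eqP e; rewrite e in ml.
rewrite expr_sum; apply: eq_big => i.
  by rewrite colorE; have := ltn_ord i; lia.
rewrite colorE => li; apply: admissible_occ_pow => //; lia.
Qed.

Lemma color_pow_range a l : admissible_vtuple m a -> (m.+1 < l)%N ->
  color_pow q a l = q ^+ range_sum a l l.
Proof.
move=> Ha ml; rewrite /color_pow /range_sum expr_sum; apply: eq_big => i.
  by rewrite -val_eqE /= eqn_leq andbC.
move=> /eqP e; apply: admissible_occ_pow => //.
by move: ml; rewrite -e colorE.
Qed.

Lemma color_pow_infinite a l : admissible_vtuple m a -> l = m.+1 :> nat ->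
  color_pow q a l = 0.
Proof.
move=> Ha e; have -> : l = color m by apply: val_inj; rewrite /= e -colorE.
by rewrite color_powE; have [_ /(_ erefl) -> _] := Ha m.
Qed.

Lemma net_move0 a : net_move a ord0 ord0 = a.
Proof. exact: net_move_id. Qed.

Lemma sub_e_infinite a l : admissible_vtuple m a -> l = m.+1 :> nat ->
  sub_e a l = a.
Proof.
move=> Ha e; have -> : l = color m by apply: val_inj; rewrite /= e -colorE.
apply/ffunP => i; rewrite ffunE; case: eqP => // /color_inj ->.
by have [_ /(_ erefl) -> _] := Ha m.
Qed.

Lemma add_e_admissible a k : admissible_vtuple m a -> in_color k ->
  admissible_vtuple m (add_e a k).
Proof.
move=> Ha Hk i; rewrite ffunE; have [h1 h2 h3] := Ha i.
case: eqP => e //; split.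
- move=> im; move: Hk; rewrite /in_color -e colorE; lia.
- by move=> /h2 ->.
- by move=> /h3; case: (a i).
Qed.

Lemma net_move_admissible a k l : admissible_vtuple m a -> in_color k ->
  out_color l -> admissible_vtuple m (net_move a k l).
Proof.
move=> Ha Hk Hl; have {}Ha := add_e_admissible Ha Hk.
move=> i; rewrite /net_move ffunE; have [h1 h2 h3] := Ha i.
case: eqP => e //; split.
- move=> im; move: Hl; rewrite /out_color -e colorE; lia.
- by move=> /h2 ->.
- by move=> /h3; case: (_ i).
Qed.

(** The coordinate of the column's own color is infinite: its power is 0, so the entries z and s for
    this exit color are z(1 - x) and s(1 - x) at x = 0, and removing the color leaves the tuple
    unchanged. Hence one formula covers the whole table. *)
Lemma queue_weightE a k c l : admissible_vtuple m a ->
  queue_weight q s z m a k c l = vertex_weight false a k c l.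
Proof.
move=> Ha; rewrite /queue_weight /vertex_weight /vertex_rate -[RHS]mulrA; cbv zeta.
congr (_ * _); rewrite colorE.
rewrite /num_weight /vertex_coef /in_color /out_color.
have e0 (j : 'I_n.+1) : j = 0%N :> nat -> j = ord0 by move=> e; apply: val_inj.
have netk (l' : 'I_n.+1) : k = ord0 -> net_move a k l' = sub_e a l'.
  by move=> ->; rewrite /net_move add_e0.
have netm : in_color k -> l = m.+1 :> nat -> net_move a k l = add_e a k.
  by move=> ik e; rewrite /net_move sub_e_infinite //; exact: add_e_admissible.
have iv (b : bool) (x : R) : (if b then x else 0) = x * b%:R.
  by case: b; rewrite ?mulr1 ?mulr0.
have -> : (l == k) = (k == l :> nat) by rewrite -val_eqE eq_sym.
have [k0|k0] := posnP k; case: (ltngtP m.+1 k) => mk; try lia;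
have [l0|l0] := posnP l; case: (ltngtP m.+1 l) => ml; try lia;
case: (ltngtP k l) => hkl; try lia;
rewrite ?mul0r ?mul1r ?mulr0 //=.
- by rewrite iv (e0 _ k0) (e0 _ l0) net_move0 /above_pow eqxx.
- by rewrite iv netk ?(e0 _ k0) // color_pow_range // above_powE //; lia.
- by rewrite !mul0r.
- rewrite iv netk ?(e0 _ k0) // sub_e_infinite // color_pow_infinite //.
  by rewrite above_powE -?ml // subr0 mulr1.
- by rewrite iv (e0 _ l0) /net_move sub_e0 /above_pow eqxx.
- by rewrite iv color_pow_range // above_powE //; lia.
- by rewrite iv color_pow_range // above_powE //; lia.
- have -> : l = k by apply: val_inj.
  by rewrite iv net_move_id color_pow_range // above_powE //; lia.
- by rewrite !mul0r.
- rewrite iv netm // ?color_pow_infinite ?above_powE -?ml ?subr0 ?mulr1 //.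
  by rewrite /in_color mk orbT.
Qed.

End vertex_weights.

Section vertex_rate_theory.
Variables (R : realType) (n : nat) (q s z : R) (m : 'I_n).
Hypotheses (hq0 : 0 <= q) (hq1 : q < 1) (hs0 : 0 <= s) (hsz : s < z).
Hypothesis (hsz1 : s * z < 1).
Implicit Types (a c : vtuple n) (k l : 'I_n.+1).
Local Notation vertex_rate := (vertex_rate q s z m).
Local Notation in_color := (in_color m).
Local Notation out_color := (out_color m).

Lemma occ_pow_ge0 o : 0 <= occ_pow q o.
Proof. by case: o => [t|] //=; exact: exprn_ge0. Qed.

Lemma occ_pow_le1 o : occ_pow q o <= 1.
Proof. by case: o => [t|] //=; rewrite exprn_ile1 // ltW. Qed.

Lemma color_pow_ge0 a l : 0 <= color_pow q a l.
Proof. by apply: prodr_ge0 => i _; exact: occ_pow_ge0. Qed.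

Lemma color_pow_le1 a l : color_pow q a l <= 1.
Proof.
by apply: prodr_ile1 => i _; rewrite occ_pow_ge0 occ_pow_le1.
Qed.

Lemma above_pow_ge0 a l : 0 <= above_pow q a l.
Proof.
rewrite /above_pow; case: ifP => // _.
by apply: prodr_ge0 => i _; exact: occ_pow_ge0.
Qed.

Lemma above_pow_le1 a l : above_pow q a l <= 1.
Proof.
rewrite /above_pow; case: ifP => // _.
by apply: prodr_ile1 => i _; rewrite occ_pow_ge0 occ_pow_le1.
Qed.

(** The possible values are 1, z - s x, z(1 - x) and s(1 - x); all are nonnegative and at most 1 + z
    because 0 <= s < z. *)
Lemma vertex_coef_bound k l (x : R) : 0 <= x <= 1 -> 0 <= vertex_coef s z k l x <= 1 + z.
Proof.
move=> /andP[x0 x1]; have z0 : 0 <= z := ltW (le_lt_trans hs0 hsz).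
have sx0 : 0 <= s * x := mulr_ge0 hs0 x0.
have zx0 : 0 <= z * x := mulr_ge0 z0 x0.
have sx1 : s * x <= s by rewrite ler_piMr.
have zx1 : z * x <= z by rewrite ler_piMr.
have sz := hsz; rewrite /vertex_coef.
do 3?[case: ifP => _]; rewrite ?mulrBr ?mulr1; move: sx0 zx0 sx1 zx1;
  move: (s * x) (z * x) => t1 t2 *; apply/andP; split; lra.
Qed.

Lemma vertex_coef_der_bound k l (x : R) : 0 <= x <= 1 -> 0 <= vertex_coef_der z k l x <= 1 + z.
Proof.
move=> /andP[x0 x1]; have z0 : 0 <= z := ltW (le_lt_trans hs0 hsz).
have zx0 : 0 <= z * x := mulr_ge0 z0 x0.
have zx1 : z * x <= z by rewrite ler_piMr.
rewrite /vertex_coef_der.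
do 3?[case: ifP => _]; rewrite ?mulrBr ?mulr1; move: zx0 zx1;
  move: (z * x) => t2 *; apply/andP; split; lra.
Qed.

Lemma vertex_rate_bound b a k l :
  0 <= vertex_rate b a k l <= (1 - s * z)^-1 * (1 + z) * above_pow q a l.
Proof.
have K0 : 0 <= (1 - s * z)^-1 by rewrite invr_ge0 subr_ge0 ltW.
have x01 : 0 <= color_pow q a l <= 1 by rewrite color_pow_ge0 color_pow_le1.
rewrite /vertex_rate -(mulrA _ (1 + z)).
have [g g01 ->] : exists2 g, 0 <= g <= 1 + z &
    (if b then der_weight q z a k l else num_weight q s z a k l)
    = g * above_pow q a l.
  case: b; [exists (vertex_coef_der z k l (color_pow q a l))|
            exists (vertex_coef s z k l (color_pow q a l))] => //.
    exact: vertex_coef_der_bound.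
  exact: vertex_coef_bound.
have /andP[g0 g1] := g01; have P0 := above_pow_ge0 a l.
have gP : 0 <= g * above_pow q a l <= (1 + z) * above_pow q a l.
  by rewrite mulr_ge0 // ler_wpM2r.
have /andP[gP0 gP1] := gP.
have U0 := le_trans gP0 gP1.
by case: (in_color k); case: (out_color l);
  rewrite ?mulr1 ?mul1r ?mul0r ?mulr0; apply/andP; split => //;
  (exact: mulr_ge0 || exact: ler_wpM2l).
Qed.

Lemma vertex_rate_ge0 b a k l : 0 <= vertex_rate b a k l.
Proof. by have /andP[] := vertex_rate_bound b a k l. Qed.

Lemma vertex_rate_colors b a k l :
  vertex_rate b a k l != 0 -> in_color k /\ out_color l.
Proof.
rewrite /vertex_rate; case: in_color; last by rewrite !mul0r mulr0 eqxx.
by case: out_color; rewrite // mulr0 !mul0r mulr0 eqxx.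
Qed.

Lemma vertex_rate_can_move b a k l :
  vertex_rate b a k l != 0 -> can_move a k l.
Proof.
rewrite /vertex_rate !mulf_eq0 !negb_or => /andP[_ /andP[_]].
by case: b => [/der_weight_can_move|/num_weight_can_move].
Qed.

(** Where the product of rates is nonzero, neither move truncates, and the two moves combine. *)
Lemma vertex_exchange_move b1 b2 a k1 k2 l1 l2 c :
  vertex_rate b1 a k1 l1 * vertex_rate b2 (net_move a k1 l1) k2 l2
    * (c == net_move (net_move a k1 l1) k2 l2)%:R
  = vertex_rate b1 a k1 l1 * vertex_rate b2 (net_move a k1 l1) k2 l2
    * (c == net_move2 a k1 k2 l1 l2)%:R.
Proof.
have [->|r1] := eqVneq (vertex_rate b1 a k1 l1) 0; first by rewrite !mul0r.
have [->|r2] := eqVneq (vertex_rate b2 (net_move a k1 l1) k2 l2) 0.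
  by rewrite mulr0 !mul0r.
by rewrite net_move_net_move //; [apply: vertex_rate_can_move r1 |
  apply: vertex_rate_can_move r2].
Qed.

Definition pair_weight b1 b2 a k1 k2 l1 l2 c : R :=
  vertex_rate b1 a k1 l1 * vertex_rate b2 (net_move a k1 l1) k2 l2
    * (c == net_move (net_move a k1 l1) k2 l2)%:R.

Lemma pair_weight_exchange a k1 k2 l1 l2 c :
  exch_rate q l2 l1 * pair_weight false false a k1 k2 l2 l1 c
  + exch_rate q k1 k2 * pair_weight false false a k1 k2 l1 l2 c
  + (1 - q) * pair_weight false true a k1 k2 l1 l2 c
  = exch_rate q l1 l2 * pair_weight false false a k1 k2 l1 l2 c
  + exch_rate q k1 k2 * pair_weight false false a k2 k1 l1 l2 c
  + (1 - q) * pair_weight true false a k1 k2 l1 l2 c.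
Proof.
rewrite /pair_weight !vertex_exchange_move.
rewrite (net_move2_permr a k1 k2 l2 l1) (net_move2_perml a k2 k1 l1 l2).
have := local_exchange q s z a k1 k2 l1 l2.
rewrite /vertex_rate /=.
set K := (1 - s * z)^-1; set I1 := (in_color k1)%:R; set I2 := (in_color k2)%:R.
set O1 := (out_color l1)%:R; set O2 := (out_color l2)%:R.
set d := (_ == _)%:R => E.
(* The prefactors, the indicators of allowed colors and the indicator of the final tuple agree in
   all six terms. *)
move: (congr1 (fun x => K * K * I1 * I2 * O1 * O2 * d * x) E) => {}E.
transitivity (K * K * I1 * I2 * O1 * O2 * d *
  (exch_rate q l2 l1 *
     (num_weight q s z a k1 l2 * num_weight q s z (net_move a k1 l2) k2 l1)
  + exch_rate q k1 k2 *
      (num_weight q s z a k1 l1 * num_weight q s z (net_move a k1 l1) k2 l2)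
  + (1 - q) *
      (num_weight q s z a k1 l1 * der_weight q z (net_move a k1 l1) k2 l2))).
  ring.
rewrite E; ring.
Qed.

End vertex_rate_theory.

(** * Columns *)

Lemma ordS_neq N (k : 'I_N) : (2 <= N)%N -> ordS k != k.
Proof.
move=> hN; rewrite -val_eqE /=; have kN := ltn_ord k.
have [e|ne] := eqVneq k.+1 N; first by rewrite e modnn; lia.
by rewrite modn_small; lia.
Qed.

Lemma iter_ordS N (i j : 'I_N) : exists r, j = iter r (@ordS N) i.
Proof.
have vE r : iter r (@ordS N) i = ((i + r) %% N)%N :> nat.
  elim: r => [|r IH]; first by rewrite addn0 modn_small.
  by rewrite iterS /= IH addnS -[in LHS]addn1 modnDml addn1.
exists (j + (N - i))%N; apply: val_inj; rewrite [RHS]vE.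
have iN := ltn_ord i; have -> : (i + (j + (N - i)) = j + N)%N by lia.
by rewrite modnDr modn_small.
Qed.

Section update.
Variables (T : choiceType) (N : nat).

Definition ffun_upd (A : {ffun 'I_N -> T}) (i : 'I_N) (t : T) :
    {ffun 'I_N -> T} :=
  [ffun j => if j == i then t else A j].

(** The sum over the entry at [i] is made the inner one. Pinning this entry to [t0] in the outer sum
    encodes the remaining entries by functions on all sites. *)
Lemma esum_upd (R : realType) (D : set T) (i : 'I_N) (t0 : T)
    (f : {ffun 'I_N -> T} -> \bar R) :
  D t0 -> (forall A : {ffun 'I_N -> T}, (forall j, D (A j)) -> (0 <= f A)%E) ->
  \esum_(A in [set A : {ffun 'I_N -> T} | forall j, D (A j)]) f A
  = \esum_(A in [set A : {ffun 'I_N -> T} | (forall j, D (A j)) /\ A i = t0])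
      \esum_(t in D) f (ffun_upd A i t).
Proof.
move=> Dt0 f0; rewrite esum_esum => [|A t [DA _] Dt]; last first.
  by apply: f0 => j; rewrite ffunE; case: eqP.
apply: reindex_esum; split.
- move=> [A t] [/= [DA _] Dt] j; rewrite ffunE; case: eqP => //.
- move=> [A t] [B u] /set_mem [/= [_ Ai] _] /set_mem [/= [_ Bi] _] e.
  have E j := congr1 (fun g : {ffun 'I_N -> T} => g j) e.
  congr (_, _); last by have := E i; rewrite /= !ffunE eqxx.
  apply/ffunP => j; have := E j; rewrite /= !ffunE.
  by case: eqP => // ->; rewrite Ai Bi.
- move=> A DA; exists (ffun_upd A i t0, A i) => /=.
    split=> //; split=> [j|]; rewrite ffunE ?eqxx //; case: eqP => // _.
  by apply/ffunP => j; rewrite !ffunE; case: eqP => // ->.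
Qed.

End update.

(** * The kernel of a column and its exchange relation *)

Section column_kernel.
Variables (R : realType) (n N : nat) (q s z : R) (m : 'I_n).
Hypotheses (hN : (2 <= N)%N).
Hypotheses (hq0 : 0 <= q) (hq1 : q < 1) (hs0 : 0 <= s) (hsz : s < z).
Hypothesis (hsz1 : s * z < 1).
Implicit Types (a c : vtuple n) (h : state n N) (b : 'I_N -> bool).
Local Notation vertex_rate := (vertex_rate q s z m).
Local Notation vertex_weight := (vertex_weight q s z m).
Local Notation pair_weight := (pair_weight q s z m).

Definition admissible_column : set {ffun 'I_N -> vtuple n} :=
  [set A | forall j, admissible_vtuple m (A j)].

(* The sites marked by [b] carry the [z]-derivative of the vertex weight. *)
Definition column_kernel b h' h : \bar R :=
  \esum_(A in admissible_column)
    (\prod_(j < N) vertex_weight (b j) (A j) (h' j) (A (ordS j)) (h j))%:E.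

Definition vacuum : vtuple n :=
  [ffun i => if i == m then None else Some 0%N].

Lemma vacuum_admissible : admissible_vtuple m vacuum.
Proof.
move=> i; rewrite ffunE; split.
- by move=> im; case: eqP => // e; rewrite e ltnn in im.
- by move=> ->; rewrite eqxx.
- by move=> im; case: eqP => // e; rewrite e ltnn in im.
Qed.

Lemma vertex_weight_ge0 (d : bool) a k c l : 0 <= vertex_weight d a k c l.
Proof. by rewrite mulr_ge0 ?vertex_rate_ge0. Qed.

Definition rest_weight b h' h (k : 'I_N) (A : {ffun 'I_N -> vtuple n}) : R :=
  \prod_(j < N | (j != k) && (j != ordS k))
    vertex_weight (b j) (A j) (h' j) (A (ordS j)) (h j).

Lemma rest_weight_ge0 b h' h k A : 0 <= rest_weight b h' h k A.
Proof. by apply: prodr_ge0 => j _; exact: vertex_weight_ge0. Qed.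

Lemma pair_weight_ge0 (d1 d2 : bool) a k1 k2 l1 l2 c :
  0 <= pair_weight d1 d2 a k1 k2 l1 l2 c.
Proof. by rewrite mulr_ge0 ?ler0n // mulr_ge0 ?vertex_rate_ge0. Qed.

Definition bond_column (k : 'I_N) : set {ffun 'I_N -> vtuple n} :=
  [set A | (forall j, admissible_vtuple m (A j)) /\ A (ordS k) = vacuum].

(** The tuple between the two sites of the bond is determined by the vertex at [k], so the inner sum
    over it has one nonzero term at most. *)
Lemma column_kernel_bond b h' h k :
  column_kernel b h' h
  = \esum_(A in bond_column k)
      (pair_weight (b k) (b (ordS k)) (A k) (h' k) (h' (ordS k))
         (h k) (h (ordS k)) (A (ordS (ordS k))) * rest_weight b h' h k A)%:E.
Proof.
have kS := ordS_neq k hN; have kSS := ordS_neq (ordS k) hN.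
rewrite /column_kernel (@esum_upd _ _ _ [set a | admissible_vtuple m a]
  (ordS k) vacuum) //; last 2 first.
- exact: vacuum_admissible.
- by move=> A _; rewrite lee_fin prodr_ge0 // => j _; exact: vertex_weight_ge0.
apply: eq_esum => A [DA _].
set k1 := h' k; set k2 := h' _; set l1 := h k; set l2 := h _.
set c := A (ordS (ordS k)).
have E t : \prod_(j < N) vertex_weight (b j) (ffun_upd A (ordS k) t j) (h' j)
      (ffun_upd A (ordS k) t (ordS j)) (h j)
    = vertex_weight (b k) (A k) k1 t l1
      * (vertex_weight (b (ordS k)) t k2 c l2 * rest_weight b h' h k A).
  rewrite (bigD1 k) //= (bigD1 (ordS k)) //=.
  rewrite !ffunE eqxx (eq_sym k) (negbTE kS) (negbTE kSS).
  congr (_ * (_ * _)); rewrite /rest_weight; apply: eq_big => // j.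
  move=> /andP[jk jSk]; rewrite !ffunE (negbTE jSk).
  by rewrite (inj_eq (@ordS_inj N)) (negbTE jk).
under eq_esum => t _ do rewrite E.
set X := rest_weight _ _ _ _ _.
(* A nonzero rate forces allowed colors, hence the determined tuple is admissible and lies in the
   range of summation. *)
have [r0|r0] := eqVneq (vertex_rate (b k) (A k) k1 l1) 0.
  rewrite /pair_weight r0 !mul0r esum1 // => t _.
  by rewrite /vertex_weight r0 !mul0r.
have [c1 c2] := vertex_rate_colors r0.
rewrite (@esum_single _ _ _ (net_move (A k) k1 l1)).
- rewrite /pair_weight /vertex_weight eqxx mulr1 !mulrA; congr (_ * _)%:E.
- exact: (net_move_admissible (DA k) c1 c2).
- by move=> t _; rewrite lee_fin mulr_ge0 ?vertex_weight_ge0 // mulr_ge0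
    ?vertex_weight_ge0 ?rest_weight_ge0.
- move=> t _ /eqP/negbTE te; rewrite /vertex_weight te.
  by rewrite mulr0 mul0r.
Qed.

Definition mark (k : 'I_N) : 'I_N -> bool := fun j => j == k.

Definition unmarked : 'I_N -> bool := fun _ => false.

Lemma swapE k h : swap k h k = h (ordS k).
Proof. by rewrite ffunE tpermL. Qed.

Lemma swapES k h : swap k h (ordS k) = h k.
Proof. by rewrite ffunE tpermR. Qed.

Lemma swapED k h j : j != k -> j != ordS k -> swap k h j = h j.
Proof. by move=> jk jS; rewrite ffunE tpermD // eq_sym. Qed.

Lemma bond_rateE k h : bond_rate q k h = exch_rate q (h k) (h (ordS k)).
Proof. by []. Qed.

Lemma exch_rate_ge0 i j : 0 <= exch_rate q i j.
Proof. by rewrite /exch_rate; case: ifP => // _; case: ifP. Qed.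

(** The local relation is summed over the rest of the column. It is stated with additions only
    because the kernels are extended reals here. *)
Lemma column_kernel_exchange k h' h :
  ((bond_rate q k (swap k h))%:E * column_kernel unmarked h' (swap k h)
   + (bond_rate q k h')%:E * column_kernel unmarked h' h
   + (1 - q)%:E * column_kernel (mark (ordS k)) h' h
  = (bond_rate q k h)%:E * column_kernel unmarked h' h
   + (bond_rate q k h')%:E * column_kernel unmarked (swap k h') h
   + (1 - q)%:E * column_kernel (mark k) h' h)%E.
Proof.
have kS := ordS_neq k hN.
have q0 : 0 <= 1 - q by rewrite subr_ge0 ltW.
rewrite !(column_kernel_bond _ _ _ k) !bond_rateE.
rewrite !swapE !swapES /unmarked /mark !eqxx (eq_sym k) (negbTE kS).
(* Swaps and marks at this bond leave the weights of all other sites unchanged. *)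
have rE b (g' g : state n N) A : (forall j, j != k -> j != ordS k ->
    [/\ b j = false, g' j = h' j & g j = h j]) ->
    rest_weight b g' g k A = rest_weight unmarked h' h k A.
  move=> H; apply: eq_bigr => j /andP[jk jS]; by have [-> -> ->] := H j jk jS.
rewrite -!esumZ ?exch_rate_ge0 //;
  try by move=> A _; rewrite lee_fin mulr_ge0 ?pair_weight_ge0 ?rest_weight_ge0.
have nn r x : 0 <= r -> (0 <= x)%E -> (0 <= r%:E * x)%E.
  by move=> r0 x0; rewrite mule_ge0 ?lee_fin.
rewrite -!esumD;
  try by move=> A _; rewrite ?adde_ge0 // nn ?exch_rate_ge0 // lee_fin mulr_ge0
    ?pair_weight_ge0 ?rest_weight_ge0.
apply: eq_esum => A _.
rewrite !rE; try by move=> j jk jS; split; rewrite ?swapED ?(negbTE jk) ?(negbTE jS).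
rewrite -!EFinM -!EFinD; congr (_ %:E).
set X := rest_weight _ _ _ _ _.
have := pair_weight_exchange q s z m (A k) (h' k) (h' (ordS k)) (h k)
  (h (ordS k)) (A (ordS (ordS k))).
move=> /(congr1 (fun x => x * X)); rewrite !mulrDl !mulrA; exact.
Qed.

End column_kernel.

(** * Convergence of the column sums *)

Section column_kernel_finite.
Variables (R : realType) (n N : nat) (q s z : R) (m : 'I_n).
Hypotheses (hq0 : 0 <= q) (hq1 : q < 1) (hs0 : 0 <= s) (hsz : s < z).
Hypothesis (hsz1 : s * z < 1).
Implicit Types (a c : vtuple n) (h : state n N) (b : 'I_N -> bool).
Local Notation vertex_rate := (vertex_rate q s z m).
Local Notation vertex_weight := (vertex_weight q s z m).

Lemma column_kernel_ge0 b h' h : (0 <= column_kernel q s z m b h' h)%E.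
Proof.
apply: esum_ge0 => A _; rewrite lee_fin prodr_ge0 // => j _.
exact: vertex_weight_ge0.
Qed.

Definition color_domain (i : 'I_n) : set (option nat) :=
  [set o | [/\ (i < m)%N -> o = Some 0%N, i = m -> o = None & (m < i)%N -> o]].

(** The sum factorizes over the colors: a geometric series for each color above that of the column,
    and a single term for every other color. *)
Lemma above_pow_summable :
  (\esum_(a in [set a : vtuple n | admissible_vtuple m a])
     (above_pow q a (color m))%:E < +oo)%E.
Proof.
pose f (i : 'I_n) o : R := if (m < i)%N then occ_pow q o else 1.
have f0 i o : 0 <= f i o by rewrite /f; case: ifP => // _; exact: occ_pow_ge0.
have fin i : \esum_(o in color_domain i) (f i o)%:E \is a fin_num.
  have pos : (0 <= \esum_(o in color_domain i) (f i o)%:E)%E.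
    by apply: esum_ge0 => o _; rewrite lee_fin.
  rewrite ge0_fin_numE //; case: (ltngtP i m) => im.
  - rewrite (@esum_single _ _ _ (Some 0%N)) ?ltry //.
    + by split=> // e; rewrite e ltnn in im.
    + by move=> o _; rewrite lee_fin.
    + by move=> o [/(_ im)].
  - apply: le_lt_trans (ltry ((1 - q)^-1)).
    apply: le_trans (esum_geometric hq0 hq1).
    rewrite -[leRHS](esum_image [set: nat] Some (fun o => (occ_pow q o)%:E)).
      rewrite /f im; apply: esum_subset => [o [_ _ /(_ im)]|o _].
        by case: o => // t _; exists t.
      by rewrite lee_fin occ_pow_ge0.
    by move=> x y _ _ [].
  - have {}im : i = m by apply: val_inj.
    rewrite (@esum_single _ _ _ None) ?ltry //.
    + by split; rewrite ?im ?ltnn.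
    + by move=> o _; rewrite lee_fin.
    + by move=> o [_ /(_ im)].
have -> : [set a : vtuple n | admissible_vtuple m a]
    = [set a : {ffun 'I_n -> option nat} | forall i, color_domain i (a i)].
  by [].
under eq_esum => a _.
  have -> : above_pow q a (color m) = \prod_(i < n) f i (a i).
    rewrite /above_pow (_ : (color m == ord0) = false) // [LHS]big_mkcond.
    apply: eq_bigr => i _.
    by rewrite /f !colorE ltnS.
  over.
rewrite (esum_prod (fun i o _ => f0 i o) (fun i => esym (fineK (fin i)))).
exact: ltry.
Qed.

Lemma column_kernel_fin_num b h' h j0 : h j0 = color m ->
  column_kernel q s z m b h' h \is a fin_num.
Proof.
move=> hj0; rewrite ge0_fin_numE ?column_kernel_ge0 //.
pose K := (1 - s * z)^-1 * (1 + z).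
have z0 : 0 <= z := ltW (le_lt_trans hs0 hsz).
have K0 : 0 <= K.
  by apply: mulr_ge0; [rewrite invr_ge0 subr_ge0 ltW|rewrite addr_ge0].
pose chain (A : {ffun 'I_N -> vtuple n}) :=
  forall j, A (ordS j) = net_move (A j) (h' j) (h j).
pose C := [set A | chain A].
(* Every vertex is bounded by [K]; the power of q is kept only at [j0], where the column's own color
   exits. *)
have bnd A : \prod_(j < N) vertex_weight (b j) (A j) (h' j) (A (ordS j)) (h j)
    <= K ^+ N * above_pow q (A j0) (color m).
  have -> : K ^+ N = K * \prod_(j < N | j != j0) K.
    rewrite prodr_const cardC1 card_ord -exprS prednK //.
    exact: leq_ltn_trans (leq0n _) (ltn_ord j0).
  rewrite (bigD1 j0) //= -hj0 [leRHS]mulrAC; apply: ler_pM.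
  - exact: vertex_weight_ge0.
  - by apply: prodr_ge0 => j _; exact: vertex_weight_ge0.
  - have /andP[r0 r1] := vertex_rate_bound m hq0 hq1 hs0 hsz hsz1 (b j0) (A j0)
      (h' j0) (h j0).
    by apply: le_trans r1; rewrite /vertex_weight ler_piMr // lern1 leq_b1.
  - apply: ler_prod => j _; rewrite vertex_weight_ge0 //=.
    have /andP[r0 r1] := vertex_rate_bound m hq0 hq1 hs0 hsz hsz1 (b j) (A j)
      (h' j) (h j).
    rewrite /vertex_weight (le_trans (ler_piMr r0 _)) ?lern1 ?leq_b1 //.
    by apply: le_trans r1 _; rewrite ler_piMr // above_pow_le1.
(* A column with some tuple not produced by the preceding vertex has weight zero. *)
have -> : column_kernel q s z m b h' h
    = \esum_(A in @admissible_column n N m `&` C)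
        (\prod_(j < N) vertex_weight (b j) (A j) (h' j) (A (ordS j)) (h j))%:E.
  apply: esum_support => A _.
    by rewrite lee_fin prodr_ge0 // => j _; exact: vertex_weight_ge0.
  move=> /= nA; congr (_ %:E).
  have [j /eqP/negbTE jA] : exists j, A (ordS j) <> net_move (A j) (h' j) (h j).
    apply: contrapT => H; apply: nA => j; apply: contrapT => H'.
    by apply: H; exists j.
  by rewrite (bigD1 j) //= {1}/vertex_weight jA mulr0 mul0r.
apply: (@le_lt_trans _ _ ((K ^+ N)%:E *
    \esum_(A in @admissible_column n N m `&` C)
      (above_pow q (A j0) (color m))%:E)%E).
  rewrite -esumZ ?exprn_ge0 //; last first.
    by move=> A _; rewrite lee_fin above_pow_ge0.
  by apply: le_esum => A _; rewrite -EFinM lee_fin.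
apply: lte_mul_pinfty; rewrite ?lee_fin ?exprn_ge0 //.
apply: le_lt_trans above_pow_summable.
(* Following the moves around the ring, the tuple at [j0] determines the column, so the sum over
   columns is at most a sum over single tuples. *)
have inj : set_inj (@admissible_column n N m `&` C)
    (fun A : {ffun 'I_N -> vtuple n} => A j0).
  move=> A B /set_mem[_ cA] /set_mem[_ cB] e; apply/ffunP => j.
  have [r ->] := iter_ordS j0 j.
  by elim: r => //= r IH; rewrite cA cB IH.
rewrite -(esum_image _ _ (fun a => (above_pow q a (color m))%:E) inj).
apply: esum_subset => [a [A [DA _] <-]|a _]; first exact: DA.
by rewrite lee_fin above_pow_ge0.
Qed.

End column_kernel_finite.

(** * Products of columns *)

Lemma esum_finType (R : realType) (T : finType) (P : pred T) (f : T -> \bar R) :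
  (forall x, P x -> (0 <= f x)%E) ->
  \esum_(x in [set x | P x]) f x = (\sum_(x | P x) f x)%E.
Proof.
move=> f0; transitivity
  (\esum_(x in [set x | P x]) (\sum_(y | P y) if x == y then f y else 0)%E).
  apply: eq_esum => x Px; rewrite -big_mkcondr (big_pred1 x) // => y /=.
  by rewrite (eq_sym y); case: eqP => [<-|]; rewrite ?andbT ?andbF.
rewrite esum_sum => [|x y _ Py]; last by case: ifP => // _; exact: f0.
apply: eq_bigr => y Py; rewrite (@esum_single _ _ _ y) ?eqxx //.
- by move=> x _; case: ifP => // _; exact: f0.
- by move=> x _ /eqP/negbTE ->.
Qed.

Section chain_sum.
Variables (R : comNzRingType) (X : finType).

(* The entry from [x0] to [x] of the matrix product t_(r-1) ... t_1 t_0. *)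
Definition chain_sum r (t : 'I_r -> X -> X -> R) (x0 x : X) : R :=
  \sum_(g : {ffun 'I_r.+1 -> X} | (g ord0 == x) && (g ord_max == x0))
    \prod_(m < r) t m (g (lift ord0 m)) (g (widen_ord (leqnSn r) m)).

Lemma chain_sum0 t x0 x : @chain_sum 0 t x0 x = (x == x0)%:R.
Proof.
rewrite /chain_sum; under eq_bigr => g _ do rewrite big_ord0.
have om : @ord_max 0 = ord0 by apply: val_inj.
have gE (g : {ffun 'I_1 -> X}) : g = [ffun=> g ord0].
  by apply/ffunP => i; rewrite ffunE ord1.
have [<-|ne] := eqVneq x x0.
  rewrite (big_pred1 [ffun=> x]) // => g /=; rewrite om andbb.
  by apply/eqP/eqP => [<-|->]; rewrite ?ffunE.
rewrite big_pred0 // => g; rewrite om; apply/negP => /andP[/eqP -> /eqP e].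
by rewrite e eqxx in ne.
Qed.

(** This splits off the factor of index 0, which acts last and produces the right boundary. *)
Lemma chain_sumS r (t : 'I_r.+1 -> X -> X -> R) x0 x :
  chain_sum t x0 x
  = \sum_y chain_sum (fun m => t (lift ord0 m)) x0 y * t ord0 y x.
Proof.
rewrite /chain_sum.
under [RHS]eq_bigr => y _ do rewrite big_distrl /=.
rewrite (exchange_big_dep (fun g : {ffun 'I_r.+1 -> X} => g ord_max == x0)) /=;
  last by move=> y g _ /andP[].
rewrite (reindex_onto (@ffun_cons r.+1 X x) (@ffun_tail r.+1 X)); last first.
  by move=> g /andP[/eqP <- _]; rewrite ffun_tailK.
apply: eq_big => [g|g /andP[/andP[_ gm] _]].
  rewrite ffun_consK eqxx andbT ffun_cons0 eqxx /=.
  have -> : @ord_max r.+1 = lift ord0 ord_max by apply: val_inj; rewrite /= /bump leq0n.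
  by rewrite ffun_consS.
rewrite (big_pred1 (g ord0)); last first.
  move=> y /=; move: gm.
  have -> : @ord_max r.+1 = lift ord0 ord_max by apply: val_inj; rewrite /= /bump leq0n.
  by rewrite ffun_consS => ->; rewrite andbT eq_sym.
rewrite big_ord_recl mulrC; congr (_ * _).
  apply: eq_bigr => m _; rewrite ffun_consS; congr (t _ _ _).
  have -> : widen_ord (leqnSn r.+1) (lift ord0 m) = lift ord0 (widen_ord (leqnSn r) m).
    by apply: val_inj.
  by rewrite ffun_consS.
have -> : widen_ord (leqnSn r.+1) ord0 = ord0 by apply: val_inj.
by rewrite ffun_cons0 ffun_consS.
Qed.

End chain_sum.

(** * Stationarity transported by intertwining kernels *)

Section balance.
Variables (R : realType) (n N : nat) (q : R).
Implicit Types (h : state n N).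

Lemma swapK k : involutive (@swap n N k).
Proof. by move=> h; apply/ffunP => j; rewrite !ffunE tpermK. Qed.

Definition balanced (P : state n N -> R) h : Prop :=
  \sum_(k < N) (bond_rate q k (swap k h) * P (swap k h) - bond_rate q k h * P h)
  = 0.

(** The two sides are the entries at [h'], [h] of the matrix products t L and L t, with L the
    generator. *)
Definition intertwines (t : state n N -> state n N -> R) h' h : Prop :=
  \sum_(k < N) (bond_rate q k (swap k h) * t h' (swap k h)
                - bond_rate q k h * t h' h)
  = \sum_(k < N) bond_rate q k h' * (t (swap k h') h - t h' h).

(** With P the product of the earlier kernels, P t L = P L t = 0 by induction. The predicates [L]
    confine the argument to states where intertwining is available; nonzero kernel entries respect
    them. *)
Lemma chain_sum_balanced r (t : 'I_r -> state n N -> state n N -> R) x0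
    (L : nat -> pred (state n N)) :
  (forall (m : 'I_r) h' h, L m h -> t m h' h != 0 -> L m.+1 h') ->
  (forall (m : 'I_r) h' h, L m h -> intertwines (t m) h' h) ->
  (forall h, L r h -> balanced (fun h => (h == x0)%:R) h) ->
  forall h, L 0%N h -> balanced (chain_sum t x0) h.
Proof.
elim: r t L => [|r IH] t L Lt It B h L0.
  have := B h L0; rewrite /balanced => B'.
  by under eq_bigr => k _ do rewrite !chain_sum0.
pose P := chain_sum (fun m => t (lift ord0 m)) x0.
have BP h' : L 1%N h' -> balanced P h'.
  apply: (IH _ (fun m => L m.+1)) => // m g' g Lg.
    by apply: (Lt (lift ord0 m)); rewrite lift0.
  by apply: (It (lift ord0 m)); rewrite lift0.
rewrite /balanced.
transitivity (\sum_h' P h' * \sum_(k < N) (bond_rate q k (swap k h) *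
    t ord0 h' (swap k h) - bond_rate q k h * t ord0 h' h)).
  under [RHS]eq_bigr => h' _ do rewrite big_distrr /=.
  rewrite exchange_big /=; apply: eq_bigr => k _.
  rewrite !chain_sumS !big_distrr /= -sumrB; apply: eq_bigr => h' _.
  by rewrite -/P; ring.
transitivity (\sum_h' P h' * \sum_(k < N) bond_rate q k h' *
    (t ord0 (swap k h') h - t ord0 h' h)).
  by apply: eq_bigr => h' _; rewrite (It ord0 h' h L0).
(* Substituting [swap k h'] for [h'] in the gain term moves the generator from the kernel onto
   [P]. *)
transitivity (\sum_h' (\sum_(k < N) (bond_rate q k (swap k h') * P (swap k h')
    - bond_rate q k h' * P h')) * t ord0 h' h).
  under eq_bigr => h' _ do rewrite big_distrr /=.
  under [RHS]eq_bigr => h' _ do rewrite big_distrl /=.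
  rewrite exchange_big [RHS]exchange_big /=; apply: eq_bigr => k _.
  under eq_bigr => h' _ do rewrite mulrBr mulrBr.
  under [RHS]eq_bigr => h' _ do rewrite mulrBl.
  rewrite !sumrB; congr (_ - _); last by apply: eq_bigr => h' _; ring.
  rewrite (reindex_inj (inv_inj (@swapK k))) /=; apply: eq_bigr => h' _.
  by rewrite swapK; ring.
rewrite big1 // => h' _.
have [->|nz] := eqVneq (t ord0 h' h) 0; first by rewrite mulr0.
by rewrite (BP h' (Lt ord0 h' h L0 nz)) mul0r.
Qed.

End balance.

Section column_intertwining.
Variables (R : realType) (n N : nat) (q s z : R) (m : 'I_n).
Hypotheses (hN : (2 <= N)%N).
Hypotheses (hq0 : 0 <= q) (hq1 : q < 1) (hs0 : 0 <= s) (hsz : s < z).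
Hypothesis (hsz1 : s * z < 1).

Definition real_kernel (h' h : state n N) : R :=
  fine (column_kernel q s z m (@unmarked N) h' h).

Lemma real_kernel_intertwines (h' h : state n N) j0 : h j0 = color m ->
  intertwines q real_kernel h' h.
Proof.
move=> hj0.
have fin b g' (g : state n N) j : g j = color m -> column_kernel q s z m b g' g \is a fin_num.
  exact: column_kernel_fin_num.
pose y k := fine (column_kernel q s z m (mark k) h' h).
(* All kernels in the exchange relation are finite, since a swap of the output keeps the color
   [color m]. Subtraction is thus allowed, and the terms in [y] telescope around the ring. *)
have E k : bond_rate q k (swap k h) * real_kernel h' (swap k h)
      - bond_rate q k h * real_kernel h' h
    = bond_rate q k h' * (real_kernel (swap k h') h - real_kernel h' h)
      + (1 - q) * (y k - y (ordS k)).
  have := column_kernel_exchange m hN hq0 hq1 hs0 hsz hsz1 k h' h.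
  have hs : swap k h (tperm k (ordS k) j0) = color m by rewrite ffunE tpermK.
  rewrite -(fineK (fin (@unmarked N) h' _ _ hs)).
  rewrite -(fineK (fin (@unmarked N) h' _ _ hj0)).
  rewrite -(fineK (fin (@unmarked N) (swap k h') _ _ hj0)).
  rewrite -(fineK (fin (mark k) h' _ _ hj0)) -(fineK (fin (mark (ordS k)) h' _ _ hj0)).
  rewrite -!EFinM -!EFinD => e. have {e} := EFin_inj e. rewrite -/(y k) -/(y (ordS k)).
  rewrite -/(real_kernel h' h) -/(real_kernel h' (swap k h)).
  by rewrite -/(real_kernel (swap k h') h) => e; lra.
rewrite /intertwines; under eq_bigr => k _ do rewrite E.
rewrite big_split /= -big_distrr /= sumrB.
have -> : \sum_k y (ordS k) = \sum_k y k.
  by rewrite [RHS](reindex_inj (@ordS_inj N)).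
by rewrite subrr mulr0 addr0.
Qed.

End column_intertwining.

(** * Conservation of colors across a column *)

Section levels.
Variables (n N : nat) (cnt : 'I_n -> nat).
Implicit Types h : state n N.

(* The horizontal colors between the columns of colors [r] and [r + 1]. *)
Definition level (r : nat) : pred (state n N) := fun h =>
  [forall i : 'I_n, #|[pred j | h j == color i]| ==
                    (if (r <= i)%N then cnt i else 0%N)].

Lemma level_color (m : 'I_n) h : (1 <= cnt m)%N -> level m h ->
  exists j, h j = color m.
Proof.
move=> c1 /forallP/(_ m); rewrite leqnn => /eqP e.
have /card_gt0P[j] : (0 < #|[pred j | h j == color m]|)%N by rewrite e.
by rewrite inE => /eqP; exists j.
Qed.

Lemma level_last h : level n h -> h = [ffun=> ord0].
Proof.
move=> /forallP H; apply/ffunP => j; rewrite ffunE; apply: val_inj => /=.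
have [//|/colorP[i e]] := posnP (h j).
have := H i; rewrite leqNgt ltn_ord /= => /eqP/card0_eq/(_ j).
by rewrite inE e eqxx.
Qed.

(** Summing the conservation law of a color over the ring cancels the vertical occupation numbers,
    so the color enters as often as it exits. Colors up to that of the column cannot enter. *)
Lemma column_level (R : realType) (q s z : R) (m : 'I_n)
    (A : {ffun 'I_N -> vtuple n}) h' h :
  (forall j, admissible_vtuple m (A j)) ->
  \prod_(j < N) vertex_weight q s z m false (A j) (h' j) (A (ordS j)) (h j) != 0
  -> level m h -> level m.+1 h'.
Proof.
move=> DA /prodf_neq0 nz /forallP lh; apply/forallP => i.
have {}nz j : vertex_rate q s z m false (A j) (h' j) (h j) != 0 /\
    A (ordS j) = net_move (A j) (h' j) (h j).
  have := nz j isT; rewrite /vertex_weight mulf_eq0 negb_or => /andP[-> /=].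
  by case: (A (ordS j) =P _) => [-> _|_]; [split|rewrite eqxx].
case: ltnP => [mi|im]; last first.
  apply/eqP/eq_card0 => j; rewrite inE; apply/negP => /eqP e.
  have [/vertex_rate_colors[+ _] _] := nz j.
  by rewrite /in_color e colorE /=; lia.
have := lh i; rewrite ltnW // => /eqP <-; apply/eqP.
pose o j := odflt 0%N (A j i).
have E j : (o (ordS j) + (h j == color i) = o j + (h' j == color i))%N.
  have [r e] := nz j; rewrite /o e net_moveE.
  have [_ _ /(_ mi)] := DA j i; case Aji : (A j i) => [t|] //= _.
  have := vertex_rate_can_move r Aji; rewrite (eq_sym (h j)) (eq_sym (h' j)).
  by lia.
have : (\sum_j (o (ordS j) + (h j == color i)) = \sum_j (o j + (h' j == color i)))%N.
  by apply: eq_bigr => j _.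
rewrite !big_split /= -(reindex_inj (@ordS_inj N) (P := xpredT) (F := o)) /=.
have cE (g : state n N) :
    #|[pred j | g j == color i]| = (\sum_j (g j == color i))%N.
  by rewrite -sum1_card big_mkcond; apply: eq_bigr => j _; rewrite inE; case: eqP.
by move=> /addnI e; rewrite !cE.
Qed.

End levels.

(** * The partition function as a product of transfer matrices *)

Section partition_sum.
Variables (R : realType) (n N : nat) (q : R) (cnt : 'I_n -> nat).
Variables (s z : 'I_n -> R).
Hypotheses (hN : (2 <= N)%N) (hcnt : forall m, (1 <= cnt m)%N).
Hypotheses (hq0 : 0 <= q) (hq1 : q < 1) (hs0 : forall m, 0 <= s m).
Hypotheses (hsz : forall m, s m < z m) (hsz1 : forall m, s m * z m < 1).
Implicit Types (eta : state n N).

Definition empty_state : state n N := [ffun=> ord0].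

Definition transfer (m : 'I_n) : state n N -> state n N -> R :=
  real_kernel q (s m) (z m) m.

Lemma transfer_level (m : 'I_n) h' h : level cnt m h -> transfer m h' h != 0 ->
  level cnt m.+1 h'.
Proof.
move=> lh nz; apply: contrapT => nl; move: nz; rewrite /transfer /real_kernel.
rewrite /column_kernel esum1 ?eqxx // => A DA; congr (_ %:E).
by apply/eqP; apply: contra_notT nl => nz; apply: column_level nz lh.
Qed.

Lemma configuration_weightE eta c : configurations eta c ->
  configuration_weight q s z c = \prod_(m < n) \prod_(j < N)
    vertex_weight q (s m) (z m) m false
      (c.2 (m, j)) (c.1 (lift ord0 m, j))
      (c.2 (m, ordS j)) (c.1 (widen_ord (leqnSn n) m, j)).
Proof.
move=> [_ _ H]; apply: eq_bigr => m _; apply: eq_bigr => j _.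
exact: queue_weightE.
Qed.

Lemma configuration_weight_ge0 eta c : configurations eta c ->
  0 <= configuration_weight q s z c.
Proof.
move=> Hc; rewrite (configuration_weightE Hc) prodr_ge0 // => m _.
by apply: prodr_ge0 => j _; apply: vertex_weight_ge0.
Qed.

Lemma esum_configurations eta : sector cnt eta ->
  \esum_(c in configurations eta) (configuration_weight q s z c)%:E
  = (chain_sum transfer empty_state eta)%:E.
Proof.
move=> Heta.
pose G := [set g : {ffun 'I_n.+1 -> state n N} |
            (g ord0 == eta) && (g ord_max == empty_state)].
pose BB := [set B : {ffun 'I_n -> {ffun 'I_N -> vtuple n}} |
             forall m, admissible_column m (B m)].
pose W (g : {ffun 'I_n.+1 -> state n N}) m (A : {ffun 'I_N -> vtuple n}) : R :=
  \prod_(j < N) vertex_weight q (s m) (z m) m false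
     (A j) (g (lift ord0 m) j) (A (ordS j)) (g (widen_ord (leqnSn n) m) j).
have W0 g m A : 0 <= W g m A.
  by apply: prodr_ge0 => j _; apply: vertex_weight_ge0.
(* A configuration is regrouped into its horizontal states and its columns; for fixed horizontal
   states the columns are independent. *)
pose e (p : {ffun 'I_n.+1 -> state n N} * {ffun 'I_n -> {ffun 'I_N -> vtuple n}})
  : configuration n N := ([ffun x => p.1 x.1 x.2], [ffun x => p.2 x.1 x.2]).
rewrite (reindex_esum (G `*`` (fun=> BB)) _ e); last first.
  split.
  - move=> [g B] [/= /andP[/eqP g0 /eqP gm] HB]; split=> /= [j|j|m j].
    + by rewrite ffunE /= gm ffunE.
    + by rewrite ffunE /= g0.
    + by rewrite ffunE; apply: HB.
  - move=> [g B] [g' B'] _ _ [e1 e2]; congr (_, _); apply/ffunP => r;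
      apply/ffunP => j.
      by have := congr1 (fun f : {ffun _ -> _} => f (r, j)) e1; rewrite !ffunE.
    by have := congr1 (fun f : {ffun _ -> _} => f (r, j)) e2; rewrite !ffunE.
  - move=> [h A] [/= h1 h2 h3].
    exists ([ffun r => [ffun j => h (r, j)]], [ffun r => [ffun j => A (r, j)]]).
      split=> /=.
        apply/andP; split; apply/eqP/ffunP => j; rewrite !ffunE; [exact: h2|].
        exact: h1.
      by move=> m j; rewrite !ffunE; exact: h3.
    by congr (_, _); apply/ffunP => -[r j]; rewrite !ffunE.
transitivity (\esum_(p in G `*`` (fun=> BB)) (\prod_(m < n) W p.1 m (p.2 m))%:E).
  apply: eq_esum => -[g B] [/= Hg HB]; rewrite (@configuration_weightE eta).
    congr (_ %:E); apply: eq_bigr => m _; apply: eq_bigr => j _.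
    by rewrite !ffunE.
  move: Hg => /andP[/eqP g0 /eqP gm]; split=> /= [j|j|m j].
  - by rewrite ffunE /= gm ffunE.
  - by rewrite ffunE /= g0.
  - by rewrite ffunE; apply: HB.
rewrite -(@esum_esum _ _ _ G (fun=> BB)
  (fun g B => (\prod_(m < n) W g m (B m))%:E)); last first.
  by move=> g B _ _; rewrite lee_fin prodr_ge0.
transitivity (\esum_(g in G) (\prod_(m < n) transfer m (g (lift ord0 m))
    (g (widen_ord (leqnSn n) m)))%:E); last first.
  rewrite esum_finType; last first.
    move=> g _; rewrite lee_fin prodr_ge0 // => m _.
    by rewrite fine_ge0 // column_kernel_ge0.
  by rewrite sumEFin.
apply: eq_esum => g /andP[/eqP g0 /eqP gm].
(* With the right color counts every kernel is finite, so [fine] loses nothing and the sum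
   factorizes. *)
have [good|bad] := boolP [forall m : 'I_n, level cnt m (g (widen_ord (leqnSn n) m))].
  apply: esum_prod => [m A _|m]; first exact: W0.
  have /level_color[//|j0 hj0] := forallP good m.
  by rewrite fineK //; apply: column_kernel_fin_num hj0.
(* Otherwise, since level 0 is the sector of [eta], some column breaks conservation for the first
   time; its weights vanish, and both sides are zero. *)
have [m [lm lSm]] : exists m : 'I_n, level cnt m (g (widen_ord (leqnSn n) m)) /\
    ~ level cnt m.+1 (g (lift ord0 m)).
  apply: contrapT => H; move/negP: bad; apply; apply/forallP => -[r rn].
  elim: r rn => [|r IH] rn.
    rewrite (_ : widen_ord _ _ = ord0) ?g0 //; exact: val_inj.
  have rn' : (r < n)%N by apply: ltnW.
  have := IH rn' => lr; apply: contrapT => nl; apply: H.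
  exists (Ordinal rn'); split=> //; move: nl.
  rewrite (_ : widen_ord _ _ = lift ord0 (Ordinal rn')) //; exact: val_inj.
have tz : transfer m (g (lift ord0 m)) (g (widen_ord (leqnSn n) m)) = 0.
  by apply/eqP; apply: contra_notT lSm => nz; apply: transfer_level nz.
rewrite (bigD1 m) //= tz mul0r; apply: esum1 => B HB; congr (_ %:E).
rewrite (bigD1 m) //= (_ : W g m (B m) = 0) ?mul0r //.
by apply/eqP; apply: contra_notT lSm => nz; apply: column_level nz lm; apply: HB.
Qed.

Lemma chain_transfer_balanced eta : sector cnt eta ->
  balanced q (chain_sum transfer empty_state) eta.
Proof.
apply: (@chain_sum_balanced _ _ _ _ _ transfer empty_state (level cnt)).
- exact: transfer_level.
- move=> m h' h /(level_color (hcnt m))[j hj].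
  exact: real_kernel_intertwines hj.
- move=> h /level_last ->; rewrite /balanced big1 // => k _.
  by rewrite !bond_rateE !ffunE /exch_rate ltnn !mul0r subrr.
Qed.

End partition_sum.

(** * Uniqueness *)

Section rearrangements.
Variables (n N : nat) (cnt : 'I_n -> nat).
Implicit Types h : state n N.

Definition rearrange (p : {perm 'I_N}) h : state n N := [ffun j => h (p j)].

Lemma rearrangeM p1 p2 h : rearrange (p1 * p2)%g h = rearrange p1 (rearrange p2 h).
Proof. by apply/ffunP => j; rewrite !ffunE permM. Qed.

Lemma sector_rearrange p h : sector cnt (rearrange p h) = sector cnt h.
Proof.
apply: eq_forallb => i; congr (_ == _).
rewrite -!sum1_card [RHS](reindex_inj (@perm_inj _ p)) /=.
by apply: eq_bigl => j; rewrite !inE ffunE.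
Qed.

Lemma sum_color_card h : (\sum_(c < n.+1) #|[pred j | h j == c]| = N)%N.
Proof.
rewrite -[RHS]card_ord -sum1_card (partition_big h xpredT) //=.
by apply: eq_bigr => c _; rewrite -sum1_card; apply: eq_bigl => j; rewrite inE.
Qed.

(** The numbers of holes agree as well, because the counts of all types add up to [N]. *)
Lemma sector_rearrangement h h' : sector cnt h -> sector cnt h' ->
  exists p, h' = rearrange p h.
Proof.
move=> /forallP H /forallP H'.
have E c : #|[pred j | h' j == c]| = #|[pred j | h j == c]|.
  have [c0|/colorP[i ->]] := posnP c; last by rewrite (eqP (H i)) (eqP (H' i)).
  have {c0}-> : c = ord0 by apply: val_inj.
  have := etrans (sum_color_card h) (esym (sum_color_card h')).
  rewrite !big_ord_recl (eq_bigr (fun i => #|[pred j | h' j == lift ord0 i]|)).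
    by move=> /addIn ->.
  by move=> i _; rewrite (eqP (H i)) (eqP (H' i)).
have C (g : state n N) c : count_mem c [tuple g j | j < N] = #|[pred j | g j == c]|.
  rewrite -sum1_count -sum1_card /= big_map big_enum_cond /=.
  by apply: eq_bigl => j; rewrite inE.
have /tuple_permP[p Hp] : perm_eq [tuple h' j | j < N] [tuple h j | j < N].
  by apply/allP => c _; rewrite /= !C E.
exists p; apply/ffunP => j; rewrite ffunE.
have := congr1 (fun t => tnth t j) (val_inj Hp).
by rewrite !tnth_mktuple.
Qed.

Lemma sector_inhabited : (\sum_(m < n) cnt m <= N)%N ->
  exists h, sector cnt h.
Proof.
move=> le; pose st := nseq (N - \sum_(m < n) cnt m) ord0 ++
  flatten [seq nseq (cnt i) (color i) | i <- enum 'I_n].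
have sz : size st = N.
  rewrite size_cat size_nseq size_flatten /shape -map_comp sumnE big_map.
  rewrite big_enum /=; under [X in (_ + X)%N]eq_bigr => i _ do rewrite size_nseq.
  by rewrite subnK.
pose h : state n N := [ffun j : 'I_N => nth ord0 st j].
exists h; apply/forallP => i; apply/eqP.
have -> : #|[pred j | h j == color i]|
    = count_mem (color i) st.
  have e : st = [seq nth ord0 st (val j) | j <- enum 'I_N].
    rewrite (map_comp (nth ord0 st) val) val_enum_ord.
    by rewrite -[LHS](mkseq_nth ord0) sz.
  rewrite [in RHS]e.
  rewrite -sum1_count -sum1_card big_map big_enum_cond /=.
  by apply: eq_bigl => j; rewrite !inE ffunE.
rewrite count_cat count_nseq /= mul0n add0n count_flatten -map_comp sumnE big_map.
rewrite big_enum /= (bigD1 i) //= count_nseq /= eqxx mul1n big1 ?addn0 // => j ji.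
by rewrite count_nseq /= (inj_eq (@color_inj n)) (negbTE ji).
Qed.

(** Adjacent transpositions generate all permutations, by induction on the distance of the
    transposed sites. *)
Lemma adjacent_swaps_invariant (T : Type) (f : state n N -> T) :
  (forall k h, sector cnt h -> f (swap k h) = f h) ->
  forall p h, sector cnt h -> f (rearrange p h) = f h.
Proof.
move=> fS; pose inv p := forall h, sector cnt h -> f (rearrange p h) = f h.
have invM p1 p2 : inv p1 -> inv p2 -> inv (p1 * p2)%g.
  move=> I1 I2 h Sh; rewrite rearrangeM I1 ?I2 //.
  by rewrite sector_rearrange.
have invS k : inv (tperm k (ordS k)) by move=> h; exact: fS.
have invT d (i j : 'I_N) : j = (i + d.+1)%N :> nat -> inv (tperm i j).
  elim: d i j => [|d IH] i j ij.
    rewrite (_ : j = ordS i) //; apply: val_inj => /=.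
    by have jN := ltn_ord j; rewrite modn_small; lia.
  have lt : (i + d.+1 < N)%N by have := ltn_ord j; lia.
  have jE : j = ordS (Ordinal lt).
    by apply: val_inj => /=; rewrite modn_small; have := ltn_ord j; lia.
  (* The site [Ordinal lt] is j - 1; conjugation by the adjacent transposition of j - 1 and j
     shortens the distance by one. *)
  have -> : tperm i j = (tperm (Ordinal lt) j * tperm i (Ordinal lt) *
      tperm (Ordinal lt) j)%g.
    rewrite -{1}[tperm (Ordinal lt) j]tpermV -mulgA -conjgE tpermJ tpermL tpermD //.
      by rewrite -val_eqE /=; lia.
    by rewrite -val_eqE /= ij; lia.
  by apply: (invM); [apply: (invM); [rewrite jE|exact: IH]|rewrite jE].
have {invT}invT i j : inv (tperm i j).
  have [ij|ji|ij] := ltngtP i j.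
  - by apply: (invT (j - i).-1); lia.
  - by rewrite tpermC; apply: (invT (i - j).-1); lia.
  - rewrite (val_inj ij) tperm1 => h _; congr f.
    by apply/ffunP => k; rewrite ffunE perm1.
move=> p; have [ts -> _] := prod_tpermP p; elim: ts => [|t ts IH] /=.
  by rewrite big_nil => h _; congr f; apply/ffunP => k; rewrite ffunE perm1.
by rewrite big_cons; apply: invM.
Qed.

End rearrangements.

(** * The master equation and uniqueness of its solution in a sector *)

Section stationarity.
Variables (R : realType) (n N : nat) (q : R) (cnt : 'I_n -> nat).
Implicit Types (h : state n N).

(** Since a swap is an involution, [swap k h] is the only state that bond [k] sends to [h]. *)
Lemma sum_generator (P : state n N -> R) h :
  \sum_g P g * generator q g h
  = \sum_(k < N) (bond_rate q k (swap k h) * P (swap k h) - bond_rate q k h * P h).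
Proof.
rewrite /generator sumrB; under eq_bigr => g _ do rewrite mulrBr.
rewrite sumrB; congr (_ - _).
  under eq_bigr => g _ do rewrite /jump_rate big_distrr /=.
  rewrite (exchange_big_dep xpredT) //=; apply: eq_bigr => k _.
  have E g : (swap k g == h) = (g == swap k h).
    by apply/eqP/eqP => [<-|->]; rewrite swapK.
  by rewrite (eq_bigl _ _ E) big_pred1_eq mulrC.
rewrite (bigD1 h) //= eqxx mulr1n [X in _ + X]big1 ?addr0 => [|g gh]; last first.
  by rewrite (negbTE gh) mulr0n mulr0.
rewrite -big_distrl /= mulrC; congr (_ * _).
rewrite /jump_rate (exchange_big_dep xpredT) //=; apply: eq_bigr => k _.
have E g : (swap k h == g) = (g == swap k h) by rewrite eq_sym.
by rewrite (eq_bigl _ _ E) big_pred1_eq.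
Qed.

(* The Dirichlet form of [Q / P] vanishes when both [P] and [Q] are balanced. *)
Lemma balanced_ratio (P Q : state n N -> R) :
  (forall h, sector cnt h -> 0 < P h) -> 0 <= q ->
  (forall h, sector cnt h -> balanced q P h) ->
  (forall h, sector cnt h -> balanced q Q h) ->
  forall k h, sector cnt h -> Q (swap k h) / P (swap k h) = Q h / P h.
Proof.
move=> P0 q0 BP BQ; pose f h := Q h / P h.
have fP h : sector cnt h -> f h * P h = Q h.
  by move=> Sh; rewrite divfK // gt_eqF // P0.
have Sswap k h : sector cnt (swap k h) = sector cnt h by exact: sector_rearrange.
have sw (G : 'I_N -> state n N -> R) :
    \sum_(k < N) \sum_(h | sector cnt h) G k (swap k h)
    = \sum_(k < N) \sum_(h | sector cnt h) G k h.
  apply: eq_bigr => k _; rewrite [RHS](reindex_inj (inv_inj (@swapK n N k))) /=.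
  by apply: eq_bigl => h; rewrite Sswap.
have balE (G : state n N -> R) h : balanced q G h ->
    \sum_(k < N) bond_rate q k (swap k h) * G (swap k h)
    = \sum_(k < N) bond_rate q k h * G h.
  by rewrite /balanced sumrB => /eqP; rewrite subr_eq0 => /eqP.
pose D := \sum_(k < N) \sum_(h | sector cnt h) bond_rate q k h * P h * f h ^+ 2.
(* After the substitution by [swap k h], the balance of [P] turns the gain at each state into its
   loss. *)
have T1 : \sum_(k < N) \sum_(h | sector cnt h)
    bond_rate q k h * P h * f (swap k h) ^+ 2 = D.
  rewrite -sw /D exchange_big [RHS]exchange_big /=; apply: eq_bigr => h Sh.
  rewrite -[RHS]big_distrl /= -(balE P h (BP h Sh)) big_distrl /=.
  by apply: eq_bigr => k _; rewrite swapK.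
(* The same argument with the balance of [Q] = [f] P handles the cross term. *)
have T2 : \sum_(k < N) \sum_(h | sector cnt h)
    bond_rate q k h * P h * (f h * f (swap k h)) = D.
  rewrite -sw /D exchange_big [RHS]exchange_big /=; apply: eq_bigr => h Sh.
  transitivity (f h * \sum_(k < N) bond_rate q k (swap k h) * Q (swap k h)).
    rewrite big_distrr /=; apply: eq_bigr => k _.
    by rewrite swapK -(fP (swap k h)) ?Sswap //; ring.
  rewrite (balE Q h (BQ h Sh)) big_distrr /=; apply: eq_bigr => k _.
  by rewrite -(fP h Sh); ring.
have DF : \sum_(k < N) \sum_(h | sector cnt h)
    bond_rate q k h * P h * (f (swap k h) - f h) ^+ 2 = 0.
  transitivity (D - D *+ 2 + D); last by ring.
  rewrite -{1}T1 -{1}T2 /D -sumrMnl -sumrB -big_split /=; apply: eq_bigr => k _.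
  rewrite -sumrMnl -sumrB -big_split /=; apply: eq_bigr => h _; ring.
have r0 k h : 0 <= bond_rate q k h.
  by rewrite /bond_rate; case: ifP => // _; case: ifP.
have nn k h : sector cnt h ->
    0 <= bond_rate q k h * P h * (f (swap k h) - f h) ^+ 2.
  move=> Sh; apply: mulr_ge0; last exact: sqr_ge0.
  by apply: mulr_ge0 => //; exact/ltW/P0.
(* A sum of nonnegative terms vanishes, so each term does. Only bonds of rate 1 are exploited, which
   covers q = 0: for unequal colors either [h] or [swap k h] has rate 1. *)
have Z k h : sector cnt h -> bond_rate q k h = 1 -> f (swap k h) = f h.
  move=> Sh rk; move/eqP: DF; rewrite psumr_eq0; last first.
    by move=> k' _; apply: sumr_ge0 => h' Sh'; exact: nn.
  move=> /allP/(_ k); rewrite mem_index_enum => /(_ isT) /=.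
  rewrite psumr_eq0; last by move=> h' Sh'; exact: nn.
  move=> /allP/(_ h); rewrite mem_index_enum => /(_ isT); rewrite Sh /= rk mul1r.
  by rewrite mulf_eq0 gt_eqF ?P0 //= sqrf_eq0 subr_eq0 => /eqP.
move=> k h Sh; rewrite -/(f _) -/(f h).
have [lt|gt|eq] := ltngtP (h k) (h (ordS k)).
- by apply: Z => //; rewrite /bond_rate lt.
- rewrite -{2}(swapK k h); apply/esym/Z; first by rewrite Sswap.
  by rewrite /bond_rate swapE swapES gt.
- congr f; apply/ffunP => j; rewrite ffunE.
  by case: tpermP => [->|->|//]; rewrite (val_inj eq).
Qed.

(** The ratio is constant on the sector, whose states are rearrangements of each other, and equal
    total masses make the constant 1. *)
Lemma balanced_unique (P Q : state n N -> R) :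
  (forall h, sector cnt h -> 0 < P h) -> 0 <= q ->
  (forall h, sector cnt h -> balanced q P h) ->
  (forall h, sector cnt h -> balanced q Q h) ->
  \sum_(h | sector cnt h) P h = \sum_(h | sector cnt h) Q h ->
  forall h, sector cnt h -> Q h = P h.
Proof.
move=> P0 q0 BP BQ eqS h Sh.
have inv := adjacent_swaps_invariant (balanced_ratio P0 q0 BP BQ).
have QP g : sector cnt g -> Q g = Q h / P h * P g.
  move=> Sg; have [p ->] := sector_rearrangement Sh Sg.
  by rewrite -(inv p h Sh) divfK // gt_eqF // P0 // sector_rearrange.
have S0 : 0 < \sum_(g | sector cnt g) P g.
  by rewrite (bigD1 h) //= ltr_wpDr ?P0 // sumr_ge0 // => g /andP[Sg _]; rewrite ltW ?P0.
move: eqS; rewrite [RHS](eq_bigr _ QP) -big_distrr /= -{1}[LHS]mul1r.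
move=> /(mulIf (lt0r_neq0 S0)) e.
by rewrite [LHS](QP h Sh) -e mul1r.
Qed.

End stationarity.

(** * A configuration of positive weight *)

Section vacuum_configuration.
Variables (R : realType) (n N : nat) (q : R) (s z : 'I_n -> R).
Hypotheses (hq0 : 0 <= q) (hs0 : forall m, 0 <= s m).
Hypotheses (hsz : forall m, s m < z m) (hsz1 : forall m, s m * z m < 1).

(* The color [c] joins at its own column and then moves straight to the right. *)
Definition joined_color (c : 'I_n.+1) (r : nat) : 'I_n.+1 :=
  if (r < c)%N then c else ord0.

Lemma above_pow_vacuum (m : 'I_n) (l : 'I_n.+1) : (m < l)%N ->
  above_pow q (vacuum m) l = 1.
Proof.
move=> ml; rewrite (above_powE q (vacuum_admissible m) ml).
rewrite /range_sum big1 ?expr0 // => i _; rewrite ffunE.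
by case: eqP.
Qed.

(** Up to the positive prefactor the weight is z - s, 1 or z, according to whether [c] is above,
    below or equal to the color of the column. *)
Lemma vacuum_weight_gt0 (m : 'I_n) (c : 'I_n.+1) :
  0 < vertex_weight q (s m) (z m) m false (vacuum m) (joined_color c m.+1)
        (vacuum m) (joined_color c m).
Proof.
have va := vacuum_admissible m; have z0 := le_lt_trans (hs0 m) (hsz m).
have K0 : 0 < (1 - s m * z m)^-1 by rewrite invr_gt0 subr_gt0.
rewrite /vertex_weight /vertex_rate /num_weight /vertex_coef /joined_color.
case: (ltngtP m.+1 c) => mc.
- have mc' : (m < c)%N by apply: ltnW.
  have ic : in_color m c by rewrite /in_color mc orbT.
  have oc : out_color m c by rewrite /out_color mc' orbT.
  rewrite ?mc' net_move_id !eqxx mulr1 ic oc !mul1r above_pow_vacuum // mulr1.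
  rewrite gtn_eqF ?(leq_ltn_trans _ mc') // mulr_gt0 // subr_gt0.
  apply: le_lt_trans (hsz m); rewrite ler_piMr //.
  have [i ->] := colorP (leq_ltn_trans (leq0n _) mc').
  by rewrite color_powE ffunE; case: eqP => //= _; rewrite expr0.
- have mc' : (m < c)%N = false by lia.
  rewrite ?mc' net_move_id !eqxx mulr1 /above_pow eqxx.
  by rewrite /in_color /out_color /= !mulr1.
- have mc' : (m < c)%N by rewrite -mc.
  have ic : in_color m ord0 by [].
  have oc : out_color m c by rewrite /out_color mc' orbT.
  rewrite ?mc' /net_move add_e0 (sub_e_infinite va (esym mc)) eqxx mulr1 ic oc !mul1r.
  rewrite above_pow_vacuum // (color_pow_infinite q va (esym mc)) subr0 !mulr1.
  by rewrite -mc /= mulr_gt0.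
Qed.

Lemma vacuum_configuration_gt0 (eta : state n N) :
  exists2 c, configurations eta c & 0 < configuration_weight q s z c.
Proof.
pose c : configuration n N := ([ffun p : 'I_n.+1 * 'I_N => joined_color (eta p.2) p.1],
                               [ffun p : 'I_n * 'I_N => vacuum p.1]).
have Hc : configurations eta c.
  split=> /= [j|j|m j]; rewrite ffunE /=.
  - by rewrite /joined_color ltnNge -ltnS ltn_ord.
  - rewrite /joined_color; case: posnP => // e; exact: val_inj.
  - exact: vacuum_admissible.
exists c => //; rewrite (configuration_weightE q s z Hc).
apply: prodr_gt0 => m _; apply: prodr_gt0 => j _; rewrite !ffunE /= /bump leq0n.
exact: vacuum_weight_gt0.
Qed.

End vacuum_configuration.

(** * Normalization of the partition function to the unique stationary distribution *)

Theorem proposition4p9 (R : realType) (n N : nat) (q : R) (cnt : 'I_n -> nat)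
    (u : R) (v s z : 'I_n -> R)
    (hn : (1 <= n)%N) (hN : (2 <= N)%N)
    (hq0 : 0 <= q) (hq1 : q < 1)
    (hcnt1 : forall m, (1 <= cnt m)%N)
    (hcntN : (\sum_(m < n) cnt m <= N)%N)
    (* for q = 0 the z_m themselves are the parameters *)
    (hz : 0 < q -> forall m, z m = u / (v m * Num.sqrt q))
    (hs0 : forall m, 0 <= s m) (hsz : forall m, s m < z m)
    (hsz1 : forall m, s m * z m < 1) :
  let F : state n N -> R := partition_function q s z in
  [/\ forall eta : state n N, sector cnt eta -> convergent_partition_function q s z eta,
      forall eta : state n N, sector cnt eta -> 0 < F eta &
      exists Prob : {ffun state n N -> R},
        [/\ stationary_distribution q cnt Prob,
            forall Prob', stationary_distribution q cnt Prob' -> Prob' = Prob &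
            forall eta : state n N, sector cnt eta ->
              Prob eta = F eta / \sum_(eta' | sector cnt eta') F eta']].
Proof.
move=> F.
pose P := chain_sum (transfer (N := N) q s z) (@empty_state n N).
have esumE eta : sector cnt eta ->
    \esum_(c in configurations eta) (configuration_weight q s z c)%:E = (P eta)%:E.
  exact: esum_configurations.
have w0 eta c : configurations eta c -> 0 <= configuration_weight q s z c.
  by move=> Hc; apply: configuration_weight_ge0 Hc.
have FP eta : sector cnt eta -> F eta = P eta.
  by move=> Se; rewrite /F /partition_function esumE.
(* The sum of nonnegative weights is at least the weight of the vacuum configuration. *)
have F0 eta : sector cnt eta -> 0 < F eta.
  move=> Se; rewrite FP // -lte_fin -esumE //.
  have [c Hc c0] := vacuum_configuration_gt0 hq0 hs0 hsz hsz1 eta.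
  apply: (@lt_le_trans _ _ (configuration_weight q s z c)%:E); first by rewrite lte_fin.
  apply: esum_ge; exists [set c]; last by rewrite fsbig_set1.
  by split=> [|_ ->]; [exact: finite_set1|].
have BF eta : sector cnt eta -> balanced q F eta.
  move=> Se; have := chain_transfer_balanced hN hcnt1 hq0 hq1 hs0 hsz hsz1 Se.
  rewrite /balanced => e; rewrite -[RHS]e; apply: eq_bigr => k _.
  by rewrite !FP // (sector_rearrange cnt (tperm k (ordS k))).
pose Z := \sum_(eta | sector cnt eta) F eta.
have Z0 : 0 < Z.
  have [h Sh] := sector_inhabited hcntN.
  rewrite /Z (bigD1 h) //= ltr_wpDr ?F0 // sumr_ge0 // => g /andP[Sg _].
  by rewrite ltW ?F0.
have Sswap k h : sector cnt (swap k h) = sector cnt h.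
  exact: (sector_rearrange cnt (tperm k (ordS k))).
pose Prob : {ffun state n N -> R} :=
  [ffun eta => if sector cnt eta then F eta / Z else 0].
have Prob1 : \sum_(eta | sector cnt eta) Prob eta = 1.
  rewrite (eq_bigr (fun eta => F eta / Z)) => [|eta Se]; last by rewrite ffunE Se.
  by rewrite -big_distrl /= divff // gt_eqF.
(* Swaps preserve the sector, so outside it every term of the master equation is zero. *)
have BProb eta : balanced q Prob eta.
  rewrite /balanced; have [Se|nSe] := boolP (sector cnt eta); last first.
    by rewrite big1 // => k _; rewrite !ffunE Sswap (negbTE nSe) !mulr0 subrr.
  have e := congr1 (fun x => x / Z) (BF eta Se).
  rewrite mul0r big_distrl /= in e; rewrite -[RHS]e; apply: eq_bigr => k _.
  by rewrite !ffunE Sswap Se mulrBl !mulrA.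
have sector_sum (Q : {ffun state n N -> R}) :
    (forall eta, ~~ sector cnt eta -> Q eta = 0) ->
    \sum_eta Q eta = \sum_(eta | sector cnt eta) Q eta.
  move=> Q0; rewrite [RHS]big_mkcond; apply: eq_bigr => eta _.
  by case: ifPn => // /Q0.
have ProbN eta : ~~ sector cnt eta -> Prob eta = 0.
  by move=> nSe; rewrite ffunE (negbTE nSe).
split=> //.
  move=> eta Se; rewrite /convergent_partition_function summableE.
  rewrite (eq_esum (b := fun c => (configuration_weight q s z c)%:E)).
    by rewrite esumE.
  by move=> c Hc; rewrite gee0_abs // lee_fin; exact: w0 Hc.
exists Prob; split.
- split=> //.
  + by move=> eta; rewrite ffunE; case: ifP => // Se; rewrite divr_ge0 // ltW // F0.
  + by rewrite sector_sum.
  + by move=> eta; rewrite sum_generator; exact: BProb.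
- move=> Q [_ Q0 Q1 QS]; apply/ffunP => eta.
  have [Se|nSe] := boolP (sector cnt eta); last by rewrite Q0 // ProbN.
  have BQ h : sector cnt h -> balanced q Q h.
    by move=> _; have := QS h; rewrite sum_generator.
  apply: (balanced_unique (cnt := cnt) (P := Prob) _ hq0) => //.
    by move=> h Sh; rewrite ffunE Sh divr_gt0 // F0.
  by rewrite -[RHS]sector_sum // Q1.
- by move=> eta Se; rewrite ffunE Se.
Qed.
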